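(* Let $y\in W_2^1(\mathcal T_\tau)$. Then $y$ is a solution of the variational problem (VP) if and only if $y\in W_2^2(\widetilde{\mathcal T})$ and $y$ is a solution of the boundary value problem $\mathcal B$.
   Context: Tree setup. Fix integers $m\ge 1$ and $0\le d<m$. Let $\mathcal T$ be a compact rooted tree with vertices $v_0,v_1,\dots,v_m$ and edges $e_1,\dots,e_m$. Here $e_j=[v_{k_j},v_j]$, with $k_1=0$ and $k_j\in\{1,\dots,d\}$ for $j=2,\dots,m$. The map $j\mapsto k_j$ is such that iterating it from any $j$ eventually reaches $1$ and then $0$, so the graph is a tree. The vertices $v_0,v_{d+1},\dots,v_m$ are the boundary vertices (each incident to exactly one edge). The vertices $v_1,\dots,v_d$ are internal. The root is $v_0$. For $j=0,\dots,d$ put $V_j:=\{\nu\in\{1,\dots,m\}: k_\nu=j\}$, the indices of the edges emanating from $v_j$. Thus $V_0=\{1\}$, and $V_j\neq\emptyset$ for $j=1,\dots,d$. Lengths and delay. Edge $e_j$ has length $T_j>0$ and is parametrized by $t\in[0,T_j]$, with $t=0$ at $v_{k_j}$ and $t=T_j$ at $v_j$. Fix $\tau\ge0$ with $\tau<T_j$ for all $j$. Set $l_j:=T_j$ for $j=1,\dots,d$ and $l_j:=T_j-\tau$ for $j=d+1,\dots,m$. Functions and spaces. A function on $\mathcal T_\tau$ is a tuple $y=[y_1,\dots,y_m]$ of real functions with $y_1$ defined on $[-\tau,T_1]$ and $y_j$ defined on $[0,T_j]$ for $j\ge2$. We use the following Sobolev spaces: - $W_2^k(\mathcal T_\tau):=W_2^k[-\tau,T_1]\oplus\bigoplus_{j=2}^mW_2^k[0,T_j]$;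 - $W_2^k(\mathcal T):=\bigoplus_{j=1}^mW_2^k[0,T_j]$; - $L_2(\mathcal T):=\bigoplus_{j=1}^m L_2(0,T_j)$. Each carries the sum of the componentwise norms squared. We write $y\in W_2^2(\widetilde{\mathcal T})$ if $y_j|_{[0,l_j]}\in W_2^2[0,l_j]$ for every $j$. Operators. Fix real constants $b_j,c_j$ for $j=1,\dots,m$. Define $$\ell_jy(t):=y_j'(t)+b_jy_j(t)+c_jy_j(t-\tau),\qquad 0<t<T_j,$$ with the following convention (the global-delay condition): for $j\ge2$ and $t\in(0,\tau)$, the value $y_j(t-\tau)$ means $y_{k_j}(t-\tau+T_{k_j})$. For $j=1$, the value $y_1(t-\tau)$ uses $y_1$ on $[-\tau,0]$. Write $\ell y:=[\ell_1y,\dots,\ell_my]$ and $$\mathcal J(y):=\sum_{j=1}^m\int_0^{T_j}(\ell_jy(t))^2\,dt,\qquad B(y,v):=\sum_{j=1}^m\int_0^{T_j}\ell_jy(t)\,\ell_jv(t)\,dt.$$ Conditions. Let $\varphi\in W_2^1[-\tau,0]$ be a given real function. - (C) continuity: $y_j(0)=y_{k_j}(T_{k_j})$ for $j=2,\dots,m$. - (I) prehistory: $y_1(t)=\varphi(t)$ for $t\in[-\tau,0]$. - (Z) target: $y_j(t)=0$ for $t\in[T_j-\tau,T_j]$, $j=d+1,\dots,m$. Variational problem (VP): find $y\in W_2^1(\mathcal T_\tau)$ satisfying (C), (I), (Z) such that $\mathcal J(y)\le\mathcal J(z)$ for every $z\in W_2^1(\mathcal T_\tau)$ satisfying (C), (I),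 (Z). Boundary value problem $\mathcal B$. Define, for the appropriate $t$, $$\tilde\ell_jy(t):=\begin{cases} c_j\,\ell_jy(t+\tau), & 0<t<T_j-\tau,\ j=1,\dots,m,\\ \sum_{\nu\in V_j}c_\nu\,\ell_\nu y(t+\tau-T_j), & T_j-\tau<t<T_j,\ j=1,\dots,d,\end{cases}$$ and $$\mathcal L_jy(t):=-(\ell_jy)'(t)+b_j\ell_jy(t)+\tilde\ell_jy(t).$$ Also set $\beta_j:=b_j-\sum_{\nu\in V_j}b_\nu$ and $\gamma_j:=c_j-\sum_{\nu\in V_j}c_\nu$ for $j=1,\dots,d$. A solution of $\mathcal B$ is a $y\in W_2^1(\mathcal T_\tau)\cap W_2^2(\widetilde{\mathcal T})$ such that: - $y$ satisfies (C), (I), (Z); - $\mathcal L_jy(t)=0$ for a.e. $t\in(0,l_j)$, for each $j=1,\dots,m$; - the Kirchhoff-type conditions hold: $$y_j'(T_j)-\sum_{\nu\in V_j}y_\nu'(0)+\beta_jy_j(T_j)+\gamma_jy_j(T_j-\tau)=0,\qquad j=1,\dots,d.$$ *)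

(* Defs.v *)
From mathcomp Require Import all_boot all_order all_algebra.
From mathcomp Require Import all_classical all_reals all_analysis.
Set Implicit Arguments. Unset Strict Implicit. Unset Printing Implicit Defensive.
Import Order.TTheory GRing.Theory Num.Theory.
Local Open Scope classical_set_scope.
Local Open Scope ring_scope.

(* g is the (weak) derivative of f on [a,b] with f in W_2^1[a,b]:
   g is Lebesgue integrable and square integrable on [a,b], and
   f t = f a + int_a^t g for every t in [a,b] (f absolutely continuous). *)
Definition is_wderiv (R : realType) (a b : R) (f g : R -> R) : Prop :=
  (lebesgue_measure).-integrable `[a, b] (fun x => (g x)%:E) /\
  (lebesgue_measure).-integrable `[a, b] (fun x => (g x ^+ 2)%:E) /\
  forall t, a <= t <= b ->
    ((f t)%:E = (f a)%:E + \int[lebesgue_measure]_(x in `[a, t]) (g x)%:E)%E.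

(* Functions on T_tau: y : nat -> R -> R, edge index j in 1..m;
   y 1 lives on [-tau, T 1], y j on [0, T j] for j >= 2. *)
Definition lo (R : realType) (tau : R) (j : nat) : R := if j == 1%N then - tau else 0.

Definition lj (R : realType) (d : nat) (T : nat -> R) (tau : R) (j : nat) : R :=
  if (j <= d)%N then T j else T j - tau.

(* y_j(t - tau) with the global-delay convention *)
Definition ydel (R : realType) (k : nat -> nat) (T : nat -> R) (tau : R)
  (y : nat -> R -> R) (j : nat) (t : R) : R :=
  if j == 1%N then y 1%N (t - tau)
  else if t < tau then y (k j) (t - tau + T (k j)) else y j (t - tau).

Definition ell (R : realType) (k : nat -> nat) (T : nat -> R) (tau : R)
  (b c : nat -> R) (y Dy : nat -> R -> R) (j : nat) (t : R) : R :=
  Dy j t + b j * y j t + c j * ydel k T tau y j t.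

Definition tell (R : realType) (m : nat) (k : nat -> nat) (T : nat -> R) (tau : R)
  (b c : nat -> R) (y Dy : nat -> R -> R) (j : nat) (t : R) : R :=
  if t < T j - tau then c j * ell k T tau b c y Dy j (t + tau)
  else \sum_(nu <- iota 1 m | k nu == j) c nu * ell k T tau b c y Dy nu (t + tau - T j).

Definition Jfun (R : realType) (m : nat) (k : nat -> nat) (T : nat -> R) (tau : R)
  (b c : nat -> R) (y Dy : nat -> R -> R) : \bar R :=
  (\sum_(j <- iota 1 m)
     \int[lebesgue_measure]_(t in `]0%R, T j[) ((ell k T tau b c y Dy j t) ^+ 2)%:E)%E.

Definition W21_tree (R : realType) (m : nat) (T : nat -> R) (tau : R)
  (y Dy : nat -> R -> R) : Prop :=
  forall j, (1 <= j <= m)%N -> is_wderiv (lo tau j) (T j) (y j) (Dy j).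

Definition conds (R : realType) (m d : nat) (k : nat -> nat) (T : nat -> R) (tau : R)
  (phi : R -> R) (y : nat -> R -> R) : Prop :=
  (forall j, (2 <= j <= m)%N -> y j 0 = y (k j) (T (k j))) /\
  (forall t, - tau <= t <= 0 -> y 1%N t = phi t) /\
  (forall j, (d + 1 <= j <= m)%N -> forall t, T j - tau <= t <= T j -> y j t = 0).

Definition solves_VP (R : realType) (m d : nat) (k : nat -> nat) (T : nat -> R) (tau : R)
  (b c : nat -> R) (phi : R -> R) (y Dy : nat -> R -> R) : Prop :=
  conds m d k T tau phi y /\
  forall z Dz : nat -> R -> R, W21_tree m T tau z Dz -> conds m d k T tau phi z ->
    (Jfun m k T tau b c y Dy <= Jfun m k T tau b c z Dz)%E.

(* y in W_2^2(tilde T): on each [0, l_j], y_j has a weak derivative D1 j which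
   itself has a weak derivative D2 j (D1 j is the absolutely continuous version of y_j') *)
Definition W22_tilde (R : realType) (m d : nat) (T : nat -> R) (tau : R)
  (y D1 D2 : nat -> R -> R) : Prop :=
  forall j, (1 <= j <= m)%N ->
    is_wderiv 0 (lj d T tau j) (y j) (D1 j) /\ is_wderiv 0 (lj d T tau j) (D1 j) (D2 j).

Definition solves_B (R : realType) (m d : nat) (k : nat -> nat) (T : nat -> R) (tau : R)
  (b c : nat -> R) (phi : R -> R) (y Dy : nat -> R -> R) : Prop :=
  exists D1 D2 : nat -> R -> R,
  W22_tilde m d T tau y D1 D2 /\
  conds m d k T tau phi y /\
  (forall j, (1 <= j <= m)%N ->
     exists w : R -> R,
       is_wderiv 0 (lj d T tau j) (ell k T tau b c y D1 j) w /\
       {ae lebesgue_measure, forall t, t \in `]0, lj d T tau j[ ->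
          - w t + b j * ell k T tau b c y Dy j t + tell m k T tau b c y Dy j t = 0}) /\
  (forall j, (1 <= j <= d)%N ->
     D1 j (T j) - \sum_(nu <- iota 1 m | k nu == j) D1 nu 0
     + (b j - \sum_(nu <- iota 1 m | k nu == j) b nu) * y j (T j)
     + (c j - \sum_(nu <- iota 1 m | k nu == j) c nu) * y j (T j - tau) = 0).

(* Main.v *)
(* Expanding J(y + s v) in s shows that y is a minimizer iff the form B(y, v)
   vanishes for all variations v obeying the homogeneous conditions.  Moving the
   delayed arguments of v onto the edges they come from turns this into the weak
   form sum_j int_0^{l_j} (ell_j y v_j' + q_j v_j) = 0, where the coefficient
   q_j = b_j ell_j y + tilde ell_j y is only in L_2.  With F_j the primitive of
   q_j, the choice v_j' := ell_j y - F_j minus its mean (no density of test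
   functions is needed) gives ell_j y = F_j + const a.e., that is, the regularity
   and the equation; piecewise linear v then give the Kirchhoff conditions.  The
   converse is integration by parts for absolutely continuous functions, an
   application of Fubini to f'(s) g'(t) on the triangle t <= s. *)
Require Import Defs.
From mathcomp Require Import all_boot all_order all_algebra.
From mathcomp Require Import all_classical all_reals all_analysis.
From mathcomp Require Import measurable_realfun zify ring lra.
Import Order.TTheory GRing.Theory Num.Theory.
Import numFieldNormedType.Exports.
Local Open Scope classical_set_scope.
Local Open Scope ring_scope.
Set Implicit Arguments.
Unset Strict Implicit.
Unset Printing Implicit Defensive.

(** * Integrals over compact intervals *)

Section IntervalIntegral.
Context {R : realType}.
Implicit Types (a b c s t : R) (f g h : R -> R).
Local Notation mu := (@lebesgue_measure R).

(** [Dy] and the version [D1] of $y_j'$ agree only almost everywhere. So [ell y Dy] and [ell y D1]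
    are compared under integrals or a.e., and the point values in the Kirchhoff conditions are taken
    of [ell y D1] alone.

    The intervals $[0,l_j]$ come from the homogeneous conditions on $v$. For $t<\tau$ the delayed
    argument on a child edge lies in the last stretch, of length $\tau$, of its parent; the root
    edge gives nothing there because $v$ has zero prehistory; on a boundary edge $v$ vanishes on its
    own last stretch.

    When the test functions are inserted, $\ell_j y$ is only in $L_2$ and cannot be integrated by
    parts. Only $F_j$ is, which turns the weak form into $\int(\ell_j y-F_j)v_j'$ plus end terms
    $F_j(l_j)v_j(l_j)$. Subtracting the mean makes $v_j$ vanish at both ends of its edge, so it
    extends by zero to the rest of the tree and the end terms drop. The Kirchhoff condition at an
    internal vertex comes from the function that is 1 at this vertex, 0 at all others and linear on
    each $[0,l_i]$. *)

Definition L1 a b f := mu.-integrable `[a, b] (fun x => (f x)%:E).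
Definition itg a b f : R := \int[mu]_(x in `[a, b]) f x.
Definition aeq a b f g := {ae mu, forall t, a <= t <= b -> f t = g t}.

Lemma mem_itvcc a b (x : R) : a <= x <= b -> x \in `[a, b]%classic.
Proof. by move=> xab; apply/mem_set; rewrite /= in_itv. Qed.

Lemma mem_itvccE a b (x : R) : (x \in `[a, b]%classic) = (a <= x <= b).
Proof. by apply/idP/idP => [|/mem_itvcc//]; rewrite inE/= in_itv. Qed.

Lemma L1_sub a b a' b' f : a <= a' -> b' <= b -> L1 a b f -> L1 a' b' f.
Proof.
move=> aa bb; apply: integrableS => //.
by apply: subset_itv; rewrite bnd_simp.
Qed.

Lemma L1_meas a b f : L1 a b f -> measurable_fun `[a, b] f.
Proof. by move=> /measurable_int/measurable_EFinP. Qed.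

Lemma L1_eq a b f g : (forall t, a <= t <= b -> f t = g t) ->
  L1 a b f -> L1 a b g.
Proof.
move=> fg; apply: eq_integrable => // x.
by rewrite inE/= in_itv/= => /fg ->.
Qed.

Lemma itg_eq a b f g : (forall t, a <= t <= b -> f t = g t) ->
  itg a b f = itg a b g.
Proof.
by move=> fg; apply: eq_Rintegral => x; rewrite inE/= in_itv/= => /fg ->.
Qed.

Lemma itg_aeq a b f g : L1 a b f -> L1 a b g -> aeq a b f g ->
  itg a b f = itg a b g.
Proof.
move=> Lf Lg fg; congr fine; apply: ae_eq_integral => //.
- exact: measurable_int Lf.
- exact: measurable_int Lg.
- apply: (@filterS _ _ (ae_filter_ringOfSetsType mu) _ _ _ fg) => x fgx.
  by rewrite /= in_itv/= => /fgx ->.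
Qed.

Lemma aeq_oo a b f g : {ae mu, forall t, a < t < b -> f t = g t} -> aeq a b f g.
Proof.
move=> [N [mN N0 NN]]; exists (N `|` ([set a] `|` [set b])); split.
- by apply: measurableU => //; apply: measurableU; exact: measurable_set1.
- apply/eqP; rewrite -measure_le0 (le_trans (measureU2 _ _ _))//=.
    by apply: measurableU; exact: measurable_set1.
  by rewrite N0 add0e (le_trans (measureU2 _ _ _))//= !lebesgue_measure_set1 adde0.
- move=> x /= /not_implyP[/andP[ax xb] fg].
  have [->|xa] := eqVneq x a; first by right; left.
  have [->|xb'] := eqVneq x b; first by right; right.
  left; apply: NN => /= H; apply: fg; apply: H.
  by rewrite !lt_neqAle ax xb eq_sym xa xb'.
Qed.

Lemma eq_oo_aeq a b f g : (forall t, a < t < b -> f t = g t) -> aeq a b f g.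
Proof. by move=> fg; apply/aeq_oo/aeW. Qed.

Lemma itg_split c a b f : a <= c -> c <= b -> L1 a b f ->
  itg a b f = itg a c f + itg c b f.
Proof.
move=> ac cb Lf; apply/eqP; rewrite addrC -subr_eq; apply/eqP.
rewrite /itg (@Rintegral_itvB _ f (BLeft a) (BRight b) c)//.
rewrite Rintegral_itv_obnd_cbnd//; apply: integrableS Lf => //.
by apply: subset_itv; rewrite bnd_simp.
Qed.

Lemma itg_point a f : itg a a f = 0.
Proof. by rewrite /itg set_itv1 Rintegral_set1. Qed.

Lemma L1D a b f g : L1 a b f -> L1 a b g -> L1 a b (fun t => f t + g t).
Proof. by move=> Lf Lg; exact: (integrableD _ Lf Lg). Qed.

Lemma L1Z k a b f : L1 a b f -> L1 a b (fun t => k * f t).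
Proof. by move=> Lf; exact: (integrableZl _ k Lf). Qed.

Lemma itgD a b f g : L1 a b f -> L1 a b g ->
  itg a b (fun t => f t + g t) = itg a b f + itg a b g.
Proof. by move=> Lf Lg; rewrite /itg RintegralD. Qed.

Lemma itgZ k a b f : L1 a b f -> itg a b (fun t => k * f t) = k * itg a b f.
Proof. by move=> Lf; rewrite /itg RintegralZl. Qed.

Lemma L1_bounded a b f M : measurable_fun `[a, b] f ->
  (forall t, a <= t <= b -> `|f t| <= M) -> L1 a b f.
Proof.
move=> mf fM; apply: measurable_bounded_integrable => //.
  by rewrite /= lebesgue_measure_itv/=; case: ifP => // _; rewrite -EFinB ltry.
exists M; split; first by rewrite num_real.
by move=> x Mx t /=; rewrite in_itv/= => /fM /le_trans; apply; exact: ltW.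
Qed.

Lemma L1_cst k a b : L1 a b (fun=> k).
Proof. by apply: (@L1_bounded _ _ _ `|k|). Qed.

Lemma itg_cst k a b : a <= b -> itg a b (fun=> k) = k * (b - a).
Proof.
move=> ab; rewrite /itg Rintegral_cst//= lebesgue_measure_itv/= lte_fin.
case: ltP => // ba; have -> : a = b by apply/eqP; rewrite eq_le ab.
by rewrite subrr mulr0.
Qed.

Lemma itg_ge0 a b f : (forall t, a <= t <= b -> 0 <= f t) -> 0 <= itg a b f.
Proof. by move=> f0; apply: Rintegral_ge0 => x /=; rewrite in_itv/= => /f0. Qed.

Lemma L1_le a b f g : measurable_fun `[a, b] f -> L1 a b g ->
  (forall t, a <= t <= b -> `|f t| <= g t) -> L1 a b f.
Proof.
move=> mf Lg fg; apply: le_integrable Lg => //; first exact/measurable_EFinP.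
move=> x /=; rewrite in_itv/= => /fg fgx; rewrite lee_fin (le_trans fgx)//.
exact: ler_norm.
Qed.

Lemma L1_norm a b f : L1 a b f -> L1 a b (fun t => `|f t|).
Proof. by move=> Lf; apply: integrable_norm. Qed.

Lemma itg_norm_le a b f : L1 a b f -> `|itg a b f| <= itg a b (fun t => `|f t|).
Proof. by move=> Lf; apply: le_normr_Rintegral. Qed.

Lemma EFin_itg a b f : L1 a b f ->
  (itg a b f)%:E = (\int[mu]_(x in `[a, b]) (f x)%:E)%E.
Proof. by move=> Lf; rewrite fineK//; exact: integrable_fin_num. Qed.

(** * Translation invariance of the integral *)

Definition translate s : measurableTypeR R -> measurableTypeR R := fun x => x + s.

Lemma measurable_translate s : measurable_fun setT (translate s).
Proof. exact: (@measurable_funD _ (measurableTypeR R)). Qed.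

(** The pushforward gives half-open intervals their length, and this determines Lebesgue measure. *)
Lemma lebesgue_shift s (A : set (measurableTypeR R)) : measurable A ->
  mu A = pushforward mu (translate s) A.
Proof.
move=> mA.
have ms := measurable_translate s.
(* [nu] is a function of the measurability proof, on which the canonical measure
   structure of [pushforward] depends. *)
pose nu := [the {measure set (measurableTypeR R) -> \bar R} of
  pushforward mu (translate s)].
apply: (@lebesgue_measure_unique R (nu ms) _ A mA) => X [[u v] /= uv <-].
rewrite /nu/= /pushforward/=.
have -> : translate s @^-1` `]u, v] = `]u - s, v - s]%classic.
  by apply/seteqP; split=> x /=; rewrite !in_itv/= ltrBlDr lerBrDr.
rewrite /= [LHS]lebesgue_measure_itv [RHS]lebesgue_measure_itv/= !lte_fin ltrD2r.
by case: ifP => // _; rewrite -!EFinB opprB addrA subrK.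
Qed.

Lemma integral_lebesgue_shift s (D : set (measurableTypeR R))
    (f : measurableTypeR R -> \bar R) :
  (\int[pushforward mu (translate s)]_(x in D) f x =
   \int[mu]_(x in D) f x)%E.
Proof.
have ms := measurable_translate s.
pose nu := [the {measure set (measurableTypeR R) -> \bar R} of
  pushforward mu (translate s)].
have := @eq_measure_integral _ _ _ D mu (nu ms) f.
apply => A mA _.
exact/esym/lebesgue_shift.
Qed.

Lemma preimage_translate_itv s a b :
  translate s @^-1` `[a + s, b + s] = `[a, b]%classic.
Proof. by apply/seteqP; split=> x /=; rewrite !in_itv/= !lerD2r. Qed.

Lemma L1_shift s a b f : L1 (a + s) (b + s) f -> L1 a b (fun t => f (t + s)).
Proof.
move=> Lf.
have ms := measurable_translate s.
have mf := L1_meas Lf.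
pose D := `[a + s, b + s]%classic.
apply/integrableP; split.
  apply/measurable_EFinP; rewrite -(preimage_translate_itv s).
  apply: (measurable_comp (F := `[a + s, b + s])) => //.
    by move=> y /= [x /= H <-].
  exact: measurable_funS ms.
move/integrableP : (Lf) => [_]; apply: le_lt_trans.
rewrite -[leRHS](integral_lebesgue_shift s) (ge0_integral_pushforward ms)//.
  by rewrite /D preimage_translate_itv.
by do 2 apply: measurableT_comp => //.
Qed.

Lemma itg_shift s a b f : L1 (a + s) (b + s) f ->
  itg a b (fun t => f (t + s)) = itg (a + s) (b + s) f.
Proof.
move=> Lf.
have ms := measurable_translate s.
have mf := L1_meas Lf.
pose D : set (measurableTypeR R) := `[a + s, b + s]%classic.
congr fine; symmetry.
transitivity (\int[pushforward mu (translate s)]_(x in D) ((f \_ D) x)%:E)%E.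
  rewrite integral_lebesgue_shift.
  by apply: eq_integral => x xD; rewrite patchE xD.
rewrite (integral_pushforward ms)//.
- rewrite preimage_translate_itv; apply: eq_integral => x.
  by rewrite inE/= in_itv/= patchE => xab; rewrite ifT// mem_itvcc// !lerD2r.
- apply/measurable_EFinP; apply/(measurable_restrictT _ _).1 => //.
  exact: measurable_itv.
- rewrite preimage_translate_itv; apply: L1_eq (L1_shift Lf) => t tab.
  by rewrite /= patchE ifT// mem_itvcc// !lerD2r.
- exact: measurable_itv.
Qed.

(** * Gluing at a point, and recovering a function from its primitive *)

Lemma meas_glue a b c f g : a <= c -> c <= b ->
  measurable_fun `[a, c] f -> measurable_fun `[c, b] g ->
  measurable_fun `[a, b] (fun t => if t < c then f t else g t).
Proof.
move=> ac cb mf mg.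
apply: measurable_fun_if => //.
- by apply: measurable_fun_ltr => //.
- apply: measurable_funS mf => // x /=; rewrite !in_itv/= => -[/andP[-> _]] xc.
  by rewrite ltW.
- apply: measurable_funS mg => // x /=; rewrite !in_itv/= => -[/andP[_ ->]].
  by rewrite leNgt => ->.
Qed.

Lemma L1_glue a b c f g : a <= c -> c <= b -> L1 a c f -> L1 c b g ->
  L1 a b (fun t => if t < c then f t else g t).
Proof.
move=> ac cb Lf Lg.
set h := fun t => _.
have mh : measurable_fun `[a, b] h by apply: meas_glue => //; exact: L1_meas.
apply/integrableP; split; first exact/measurable_EFinP.
have mh' : measurable_fun `[a, b] (fun x => `|(h x)%:E|%E).
  by do 2 apply: measurableT_comp => //.
have abE : `[a, b]%classic = `[a, c] `|` `]c, b] :> set R.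
  by rewrite -itv_bndbnd_setU// bnd_simp.
rewrite abE ge0_integral_setU//=; last 2 first.
- by rewrite -abE.
- apply/disj_set2P/seteqP; split=> x //=; rewrite !in_itv/= => -[/andP[_ xc] /andP[cx _]].
  by move: (le_lt_trans xc cx); rewrite ltxx.
have aux u v k : L1 u v k -> (\int[mu]_(x in `[u, v]) `|(k x)%:E| < +oo)%E.
  by case/integrableP.
apply: lte_add_pinfty.
(* At [c] itself [h] takes the value of [g], so [h] and [f] agree on [[a, c]] only off one point. *)
- have -> : (\int[mu]_(x in `[a, c]) `|(h x)%:E| = \int[mu]_(x in `[a, c]) `|(f x)%:E|)%E.
    apply: ae_eq_integral => //.
    + by apply: measurable_funS mh' => //; rewrite abE; exact: subsetUl.
    + by do 2 apply: measurableT_comp => //; exact: L1_meas.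
    + have := @eq_oo_aeq a c h f; case.
        by move=> t /andP[_ tc]; rewrite /h tc.
      move=> N [mN N0 NN]; exists N; split => // x /= H; apply: NN => /= K; apply: H.
      by rewrite in_itv/= => /K ->.
  exact: aux.
- have -> : (\int[mu]_(x in `]c, b]) `|(h x)%:E| = \int[mu]_(x in `]c, b]) `|(g x)%:E|)%E.
    apply: eq_integral => x; rewrite inE/= in_itv/= => /andP[cx _].
    by rewrite /h ltNge ltW.
  rewrite integral_itv_obnd_cbnd; first exact: aux.
  do 2 apply: measurableT_comp => //.
  by apply: measurable_funS (L1_meas Lg) => //; apply: subset_itv; rewrite bnd_simp.
Qed.

(** By Lebesgue differentiation the primitive of [g] has derivative [g] almost everywhere, and this
    primitive is constantly 0. Uniqueness of weak derivatives rests on this. *)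
Lemma ae0_itg a b g : a <= b -> L1 a b g ->
  (forall t, a <= t <= b -> itg a t g = 0) -> aeq a b g (fun=> 0).
Proof.
move=> ab Lg g0.
pose D := `[a, b]%classic.
pose f := g \_ D.
have Lf u v : mu.-integrable [set` Interval u v] (EFin \o f).
  apply: integrableS (measurableT) _ _ _ => //.
  rewrite /f -restrict_EFin; exact: (integrable_mkcond _ _).1 Lg.
have locf : locally_integrable setT f by exact: (integrable_locally_restrict _ Lg).
have := @FTC1 R f (BLeft a) (fun y => Lf _ _) locf.
move=> /= H.
apply: aeq_oo.
apply: (@filterS _ _ (ae_filter_ringOfSetsType mu) _ _ _ H) => x Hx /andP[ax xb].
  have [|_ ] := Hx; first by rewrite lte_fin.
  rewrite /f patchE ifT; last by rewrite mem_itvcc// !ltW.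
  move=> <-.
  (* Only a neighbourhood of the interior point [x] matters, and there the primitive of the
     extension [f] is that of [g], hence 0. *)
  rewrite derive1E; rewrite (@near_eq_derive _ _ _ _ (cst 0)) ?derive_cst//.
  near=> z; rewrite -[RHS](g0 z); last first.
    by apply/andP; split; apply: ltW; near: z; [exact: lt_nbhsr|exact: lt_nbhsl].
  apply: eq_Rintegral => t; rewrite inE/= in_itv/= => /andP[at_ tz].
  rewrite patchE ifT// mem_itvcc// at_/= (le_trans tz)//.
  by apply: ltW; near: z; exact: lt_nbhsl.
Unshelve. all: by end_near. Qed.

(** * Square integrability and weak derivatives *)

Definition L2 a b f := L1 a b f /\ L1 a b (fun t => f t ^+ 2).

(** On a bounded interval the constant 1 is integrable, and $|f|\le 1+f^2$. *)
Lemma L2P a b f : measurable_fun `[a, b] f -> L1 a b (fun t => f t ^+ 2) -> L2 a b f.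
Proof.
move=> mf L; split => //.
apply: (L1_le (g := fun t => 1 + f t ^+ 2)) => //.
  by apply: L1D => //; exact: L1_cst.
move=> t _; have /= := sqr_ge0 (`|f t| - 1); rewrite sqrrB1 -normrX ger0_norm ?sqr_ge0//.
by have := normr_ge0 (f t); lra.
Qed.

Lemma L2_meas a b f : L2 a b f -> measurable_fun `[a, b] f.
Proof. by case=> /L1_meas. Qed.

(** The elementary bound $|fg|\le f^2+g^2$ suffices in place of the Cauchy-Schwarz inequality. *)
Lemma L2M a b f g : L2 a b f -> L2 a b g -> L1 a b (fun t => f t * g t).
Proof.
move=> Lf Lg; apply: (L1_le (g := fun t => f t ^+ 2 + g t ^+ 2)).
- by apply: measurable_funM; exact: L2_meas.
- by apply: L1D; [case: Lf|case: Lg].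
- move=> t _; rewrite ler_norml.
  have := sqr_ge0 (f t - g t); have := sqr_ge0 (f t + g t).
  have := sqr_ge0 (f t); have := sqr_ge0 (g t).
  rewrite sqrrB sqrrD; set p := f t * g t; set q := f t ^+ 2; set r := g t ^+ 2.
  by move=> *; apply/andP; split; lra.
Qed.

Lemma L2D a b f g : L2 a b f -> L2 a b g -> L2 a b (fun t => f t + g t).
Proof.
move=> Lf Lg; split; first by apply: L1D; [case: Lf|case: Lg].
apply: (L1_eq (f := fun t => f t ^+ 2 + (2 * (f t * g t) + g t ^+ 2))).
  by move=> t _; ring.
by apply: L1D; [case: Lf|apply: L1D; [apply/L1Z/L2M|case: Lg]].
Qed.

Lemma L2Z k a b f : L2 a b f -> L2 a b (fun t => k * f t).
Proof.
move=> [Lf Lf2]; split; first exact: L1Z.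
by apply: (L1_eq (f := fun t => k ^+ 2 * f t ^+ 2)) => [t _|]; [ring|exact: L1Z].
Qed.

Lemma L2_eq a b f g : (forall t, a <= t <= b -> f t = g t) -> L2 a b f -> L2 a b g.
Proof.
move=> fg [L L']; split; first exact: L1_eq L.
by apply: L1_eq L' => t /fg ->.
Qed.

Lemma L2_sub a b a' b' f : a <= a' -> b' <= b -> L2 a b f -> L2 a' b' f.
Proof. by move=> aa bb [L L']; split; apply: L1_sub; eassumption. Qed.

Lemma L2_bounded a b f M : measurable_fun `[a, b] f ->
  (forall t, a <= t <= b -> `|f t| <= M) -> L2 a b f.
Proof.
move=> mf fM; apply: L2P => //; apply: (L1_bounded (M := M ^+ 2)).
  exact: measurable_funX.
by move=> t /fM fMt; rewrite normrX lerXn2r ?nnegrE// (le_trans _ fMt).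
Qed.

Lemma L2_cst k a b : L2 a b (fun=> k).
Proof. by split; exact: L1_cst. Qed.

Lemma L2_shift s a b f : L2 (a + s) (b + s) f -> L2 a b (fun t => f (t + s)).
Proof. by move=> [L L']; split; [exact: L1_shift L|exact: L1_shift L']. Qed.

Lemma L2_glue a b c f g : a <= c -> c <= b -> L2 a c f -> L2 c b g ->
  L2 a b (fun t => if t < c then f t else g t).
Proof.
move=> ac cb [Lf Lf'] [Lg Lg']; split; first exact: L1_glue.
by apply: L1_eq (L1_glue ac cb Lf' Lg') => t _ /=; case: ifP.
Qed.

Lemma L2_sum (I : Type) (r : seq I) (P : pred I) a b (F : I -> R -> R) :
  (forall i, P i -> L2 a b (F i)) -> L2 a b (fun t => \sum_(i <- r | P i) F i t).
Proof.
move=> LF; elim: r => [|i r IH].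
  by apply: L2_eq (L2_cst 0 a b) => t _; rewrite big_nil.
case Pi : (P i); last by apply: L2_eq IH => t _; rewrite big_cons Pi.
by apply: L2_eq (L2D (LF _ Pi) IH) => t _; rewrite big_cons Pi.
Qed.

Lemma L1_sum (I : Type) (r : seq I) (P : pred I) a b (F : I -> R -> R) :
  (forall i, P i -> L1 a b (F i)) -> L1 a b (fun t => \sum_(i <- r | P i) F i t).
Proof.
move=> LF; elim: r => [|i r IH].
  by apply: L1_eq (L1_cst 0 a b) => t _; rewrite big_nil.
case Pi : (P i); last by apply: L1_eq IH => t _; rewrite big_cons Pi.
by apply: L1_eq (L1D (LF _ Pi) IH) => t _; rewrite big_cons Pi.
Qed.

Lemma itg_sum (I : Type) (r : seq I) (P : pred I) a b (F : I -> R -> R) :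
  a <= b -> (forall i, P i -> L1 a b (F i)) ->
  itg a b (fun t => \sum_(i <- r | P i) F i t) = \sum_(i <- r | P i) itg a b (F i).
Proof.
move=> ab LF; elim: r => [|i r IH].
  by under itg_eq do rewrite big_nil; rewrite big_nil itg_cst ?mul0r.
rewrite big_cons -IH; case: ifPn => Pi.
  rewrite -itgD; [|exact: LF|exact: L1_sum].
  by apply: itg_eq => t _; rewrite big_cons Pi.
by apply: itg_eq => t _; rewrite big_cons (negbTE Pi).
Qed.

Lemma wderivP a b f g : is_wderiv a b f g <->
  L2 a b g /\ forall t, a <= t <= b -> f t = f a + itg a t g.
Proof.
split=> [[L [L' fE]]|[[L L'] fE]].
  split=> // t tab; have := fE _ tab.
  rewrite -EFin_itg; last by apply: L1_sub L => //; case/andP : tab.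
  by move=> [].
split=> //; split=> // t tab.
rewrite -EFin_itg; last by apply: L1_sub L => //; case/andP : tab.
by rewrite -EFinD -fE.
Qed.

Lemma wderiv_L2D a b f g : is_wderiv a b f g -> L2 a b g.
Proof. by move/wderivP => []. Qed.

Lemma wderivE a b f g t : is_wderiv a b f g -> a <= t <= b -> f t = f a + itg a t g.
Proof. by move/wderivP => [_]; apply. Qed.

Lemma wderiv_int k a b g : L2 a b g -> is_wderiv a b (fun t => k + itg a t g) g.
Proof. by move=> L; apply/wderivP; split=> // t _; rewrite itg_point addr0. Qed.

Lemma itg_meas a b g : a <= b -> L1 a b g -> measurable_fun `[a, b] (fun t => itg a t g).
Proof.
move=> ab Lg; apply: subspace_continuous_measurable_fun => //.
exact: parameterized_integral_continuous.
Qed.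

(** A primitive is continuous, hence measurable, and bounded by $\int_a^b|g|$. *)
Lemma wderiv_L2 a b f g : a <= b -> is_wderiv a b f g -> L2 a b f.
Proof.
move=> ab /wderivP[[Lg Lg2] fE].
apply: (L2_eq (f := fun t => f a + itg a t g)) => [t tab|]; first by rewrite -fE.
apply: L2D; first exact: L2_cst.
apply: (@L2_bounded _ _ _ (itg a b (fun t => `|g t|))); first exact: itg_meas.
move=> t /andP[at_ tb].
have Lt : L1 a t g by apply: L1_sub Lg.
rewrite (le_trans (itg_norm_le Lt))// (itg_split at_ tb (L1_norm Lg)) lerDl.
by apply: itg_ge0.
Qed.

Lemma wderiv_eq a b f g f' g' : a <= b -> (forall t, a <= t <= b -> f t = f' t) ->
  (forall t, a <= t <= b -> g t = g' t) -> is_wderiv a b f g -> is_wderiv a b f' g'.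
Proof.
move=> ab ff gg /wderivP[L fE]; apply/wderivP; split; first exact: L2_eq L.
move=> t /andP[at_ tb]; rewrite -!ff ?lexx ?at_ ?ab// fE ?at_//; congr (_ + _).
by apply: itg_eq => s /andP[sa st]; apply: gg; rewrite sa (le_trans st).
Qed.

Lemma aeq_sub a b a' b' f g : a <= a' -> b' <= b -> aeq a b f g -> aeq a' b' f g.
Proof.
move=> aa bb; apply: (@filterS _ _ (ae_filter_ringOfSetsType mu)) => t + /andP[ta tb].
by apply; rewrite (le_trans aa) ?(le_trans tb).
Qed.

Lemma wderiv_aeq a b f g g' : L2 a b g' -> aeq a b g g' ->
  is_wderiv a b f g -> is_wderiv a b f g'.
Proof.
move=> L' gg /wderivP[L fE]; apply/wderivP; split=> // t /andP[at_ tb].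
rewrite fE ?at_//; congr (_ + _); apply: itg_aeq.
- by apply: L1_sub L.1.
- by apply: L1_sub L'.1.
- exact: aeq_sub gg.
Qed.

Lemma wderivD a b f g f' g' : is_wderiv a b f g -> is_wderiv a b f' g' ->
  is_wderiv a b (fun t => f t + f' t) (fun t => g t + g' t).
Proof.
move=> /wderivP[L fE] /wderivP[L' fE']; apply/wderivP; split; first exact: L2D.
move=> t tab; rewrite fE// fE'// itgD; first by ring.
- by apply: L1_sub L.1 => //; case/andP : tab.
- by apply: L1_sub L'.1 => //; case/andP : tab.
Qed.

Lemma wderivZ k a b f g : is_wderiv a b f g ->
  is_wderiv a b (fun t => k * f t) (fun t => k * g t).
Proof.
move=> /wderivP[L fE]; apply/wderivP; split; first exact: L2Z.
move=> t tab; rewrite fE// itgZ; first by ring.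
by apply: L1_sub L.1 => //; case/andP : tab.
Qed.

Lemma wderiv_sub a b a' b' f g : a <= a' -> a' <= b' -> b' <= b ->
  is_wderiv a b f g -> is_wderiv a' b' f g.
Proof.
move=> aa ab bb /wderivP[L fE]; apply/wderivP; split; first exact: L2_sub L.
move=> t /andP[at_ tb].
rewrite fE; last by rewrite (le_trans aa) ?(le_trans tb).
rewrite [f a']fE; last by rewrite aa (le_trans ab).
rewrite -addrA; congr (_ + _); apply: itg_split => //.
by apply: L1_sub L.1 => //; exact: le_trans bb.
Qed.

Lemma wderiv_shift s a b f g : is_wderiv (a + s) (b + s) f g ->
  is_wderiv a b (fun t => f (t + s)) (fun t => g (t + s)).
Proof.
move=> /wderivP[L fE]; apply/wderivP; split; first exact: L2_shift.
move=> t /andP[at_ tb]; rewrite fE ?lerD2r ?at_//; congr (_ + _).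
by rewrite itg_shift//; apply: L1_sub L.1 => //; rewrite lerD2r.
Qed.

Lemma wderiv_glue a b c f g f' g' : a <= c -> c <= b -> f c = f' c ->
  is_wderiv a c f g -> is_wderiv c b f' g' ->
  is_wderiv a b (fun t => if t < c then f t else f' t) (fun t => if t < c then g t else g' t).
Proof.
move=> ac cb fc W W'; have /wderivP[L fE] := W; have /wderivP[L' fE'] := W'.
have LL := L2_glue ac cb L L'.
apply/wderivP; split=> //.
(* At [c] the glued derivative takes the value of [g'], which costs one point when [t = c]. *)
have h1 t : a <= t <= c -> itg a t (fun t => if t < c then g t else g' t) = itg a t g.
  move=> /andP[at_ tc]; apply: itg_aeq.
  - by apply: L1_sub LL.1 => //; exact: le_trans cb.
  - by apply: L1_sub L.1.
  - by apply: eq_oo_aeq => x /andP[_ xt]; rewrite (lt_le_trans xt).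
have fa : (if a < c then f a else f' a) = f a.
  by case: ltP => // ca; have -> : a = c; [apply/eqP; rewrite eq_le ac|].
move=> t /andP[at_ tb]; rewrite fa; case: ltP => tc.
  by rewrite h1 ?at_ ?ltW// fE// at_ ltW.
rewrite (itg_split ac tc); last by apply: L1_sub LL.1.
rewrite h1 ?ac ?lexx// addrA -fE ?ac ?lexx// fc fE' ?tc//; congr (_ + _).
by apply: itg_eq => x /andP[cx _]; rewrite ltNge cx.
Qed.

Lemma wderiv_unique a b f g g' : a <= b -> is_wderiv a b f g -> is_wderiv a b f g' ->
  aeq a b g g'.
Proof.
move=> ab W W'.
have /wderivP[L fE] := wderivD W (wderivZ (-1) W').
have : aeq a b (fun t => g t + -1 * g' t) (fun=> 0).
  apply: ae0_itg => //; first by case: L.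
  by move=> t /fE; rewrite !mulN1r !subrr add0r => <-.
apply: (@filterS _ _ (ae_filter_ringOfSetsType mu)) => t H /H.
by rewrite mulN1r => /eqP; rewrite subr_eq0 => /eqP.
Qed.

(** * Fubini on a triangle and integration by parts *)

(** Both sides are iterated integrals of $u(s)v(t)$ over $a\le t\le s\le b$. Extending [u] and [v]
    by zero and writing the triangle as a 0-1 factor gives a function on the whole plane. *)
Lemma itg_swap a b u v : a <= b -> L1 a b u -> L1 a b v ->
  itg a b (fun s => u s * itg a s v) = itg a b (fun t => v t * itg t b u).
Proof.
move=> ab Lu Lv.
pose D := `[a, b]%classic : set (measurableTypeR R).
pose U := u \_ D; pose V := v \_ D.
have mU : measurable_fun setT U.
  by apply/(measurable_restrictT _ _).1; [exact: measurable_itv|exact: L1_meas].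
have mV : measurable_fun setT V.
  by apply/(measurable_restrictT _ _).1; [exact: measurable_itv|exact: L1_meas].
pose F (x : measurableTypeR R * measurableTypeR R) : \bar R :=
  (U x.1 * V x.2 * (if x.2 <= x.1 then 1 else 0))%:E.
have mF : measurable_fun setT F.
  apply/measurable_EFinP; apply: measurable_funM; first apply: measurable_funM.
  - by apply: measurableT_comp => //.
  - by apply: measurableT_comp => //.
  - apply: measurable_fun_ifT => //; apply: measurable_fun_ler => //.
have LU : mu.-integrable setT (EFin \o U).
  by rewrite /U -restrict_EFin; exact: (integrable_mkcond _ _).1 Lu.
have LV : mu.-integrable setT (EFin \o V).
  by rewrite /V -restrict_EFin; exact: (integrable_mkcond _ _).1 Lv.
have iF : (mu \x mu)%E.-integrable setT F.
  apply/integrable12ltyP => //.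
  have /integrableP[mU' U'] := LU. have /integrableP[mV' V'] := LV.
  (* The 0-1 factor only decreases the modulus, so $|U(x)||V(y)|$ dominates; its double integral is
     a product of two finite ones. *)
  apply: (@le_lt_trans _ _ (\int[mu]_x (`|(U x)%:E| * \int[mu]_y `|(V y)%:E|))%E); last first.
    have IU : (\int[mu]_x `|(U x)%:E|)%E \is a fin_num.
      by rewrite ge0_fin_numE//; exact: integral_ge0.
    rewrite ge0_integralZr//.
      by apply: lte_mul_pinfty => //; exact: integral_ge0.
      by apply: measurableT_comp.
    exact: integral_ge0.
  apply: ge0_le_integral => //.
  - by move=> x _; exact: integral_ge0.
  - by apply: (measurable_fun_fubini_tonelli_F (abse \o F)) => //=; apply: measurableT_comp.
  - apply: emeasurable_funM => //; exact: measurableT_comp.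
  - move=> x _; rewrite -ge0_integralZl//; last by apply: measurableT_comp.
    apply: ge0_le_integral => //.
    + apply: measurableT_comp => //; apply: measurableT_comp => //.
    + by apply: measurable_funeM; apply: measurableT_comp.
    + move=> y _; rewrite /F /= lee_fin normrM normrM ler_piMr ?mulr_ge0//.
      by case: ifP => _; rewrite ?normr1 ?normr0.
have := Fubini iF; rewrite /F /= => FE.
rewrite /itg /Rintegral; congr fine.
transitivity (\int[mu]_x \int[mu]_y (U x * V y * (if (y <= x)%R then 1 else 0))%:E)%E.
  rewrite integral_mkcond; apply: eq_integral => x _; rewrite patchE; case: ifPn => xD; last first.
    by rewrite integral0_eq// => y _; rewrite /U patchE (negbTE xD) !mul0r.
  move: (xD); rewrite mem_itvccE => /andP[ax xb].
  rewrite EFinM (_ : (fine _)%:E = (itg a x v)%:E)// EFin_itg; last exact: L1_sub Lv.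
  rewrite -integralZl//; last by apply: L1_sub Lv.
  rewrite integral_mkcond; apply: eq_integral => y _; rewrite /U /V !patchE xD.
  rewrite -EFinM /D !mem_itvccE; have [yx|xy] := leP y x.
    by rewrite mulr1 andbT (le_trans yx xb) andbT; case: ifP => // _; rewrite mulr0.
  by rewrite andbF mulr0.
rewrite FE; symmetry.
rewrite integral_mkcond; apply: eq_integral => y _; rewrite patchE; case: ifPn => yD; last first.
  by rewrite integral0_eq// => x _; rewrite /V patchE (negbTE yD) mulr0 mul0r.
move: (yD); rewrite mem_itvccE => /andP[ay yb].
rewrite EFinM (_ : (fine _)%:E = (itg y b u)%:E)// EFin_itg; last exact: L1_sub Lu.
rewrite -integralZl//; last by apply: L1_sub Lu.
rewrite integral_mkcond; apply: eq_integral => x _; rewrite /U /V !patchE yD.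
rewrite -EFinM /D !mem_itvccE; have [yx|xy] := leP y x.
  by rewrite mulr1/= (le_trans ay yx)/=; case: ifP => _; [rewrite mulrC|rewrite mul0r].
by rewrite mulr0.
Qed.

(** With $f$ and $g$ written as initial value plus primitive, only the product of the two primitives
    is at stake. Swapping one triangle and using $\int_t^b f'=\int_a^b f'-\int_a^t f'$ cancels the
    other one and leaves $\int_a^b f'\int_a^b g'$. *)
Lemma wderiv_parts a b f f' g g' : a <= b -> is_wderiv a b f f' -> is_wderiv a b g g' ->
  itg a b (fun t => f t * g' t + f' t * g t) = f b * g b - f a * g a.
Proof.
move=> ab Wf Wg.
have [Lf' Lg'] := (wderiv_L2D Wf, wderiv_L2D Wg).
have [Lf Lg] := (wderiv_L2 ab Wf, wderiv_L2 ab Wg).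
have Lif : L2 a b (fun t => itg a t f').
  apply: (L2_eq (f := fun t => f t + (- f a))) => [t tab|].
    by rewrite (wderivE Wf tab) addrC addKr.
  by apply: L2D => //; exact: L2_cst.
have Lig : L2 a b (fun t => itg a t g').
  apply: (L2_eq (f := fun t => g t + (- g a))) => [t tab|].
    by rewrite (wderivE Wg tab) addrC addKr.
  by apply: L2D => //; exact: L2_cst.
have [L1f' L1g'] := (Lf'.1, Lg'.1).
rewrite itgD; [|exact: L2M..].
have -> : itg a b (fun t => f t * g' t) = f a * itg a b g' + itg a b (fun t => itg a t f' * g' t).
  rewrite -itgZ// -itgD; [|exact: L1Z|exact: L2M].
  by apply: itg_eq => t tab; rewrite (wderivE Wf tab); ring.
have -> : itg a b (fun t => f' t * g t) = g a * itg a b f' + itg a b (fun t => f' t * itg a t g').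
  rewrite -itgZ// -itgD; [|exact: L1Z|exact: L2M].
  by apply: itg_eq => t tab; rewrite (wderivE Wg tab); ring.
rewrite itg_swap//.
have -> : itg a b (fun t => g' t * itg t b f') =
  itg a b f' * itg a b g' + - 1 * itg a b (fun t => itg a t f' * g' t).
  rewrite -!itgZ//; last exact: L2M.
  rewrite -itgD; [|exact: L1Z|by apply/L1Z/L2M].
  by apply: itg_eq => t /andP[at_ tb]; rewrite (itg_split at_ tb)//; ring.
have bab : a <= b <= b by rewrite ab lexx.
rewrite (wderivE Wf bab) (wderivE Wg bab); ring.
Qed.

(** Since $f^2\ge 0$, a zero total integral forces every partial integral of $f^2$ to be zero. *)
Lemma L2_itg0_aeq (a l : R) (f : R -> R) : a <= l -> L2 a l f ->
  itg a l (fun t => f t ^+ 2) = 0 -> aeq a l f (fun=> 0).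
Proof.
move=> al [_ L] f0.
have H : aeq a l (fun t => f t ^+ 2) (fun=> 0).
  apply: ae0_itg => // t /andP[at_ tl]; apply/eqP; rewrite eq_le.
  rewrite [0 <= _]itg_ge0 ?andbT; last by move=> x _; exact: sqr_ge0.
  rewrite -f0 (itg_split at_ tl L) lerDl; apply: itg_ge0 => x _; exact: sqr_ge0.
apply: (@filterS _ _ (ae_filter_ringOfSetsType mu) _ _ _ H) => t + tl.
by move=> /(_ tl)/eqP; rewrite sqrf_eq0 => /eqP.
Qed.

End IntervalIntegral.

(** At $s=-B/(Q+1)$ one has $B=-s(Q+1)$, so the quadratic equals $-s^2(Q+2)$ and $s=0$. Dividing by
    $Q+1$ instead of $Q$ covers the degenerate case $Q=0$. *)
Lemma quadratic_min (R : realFieldType) (B Q : R) : 0 <= Q ->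
  (forall s : R, 0 <= 2 * s * B + s ^+ 2 * Q) -> B = 0.
Proof.
move=> Q0 H.
have Q1 : 0 < Q + 1 by rewrite ltr_wpDl.
have := H (- B / (Q + 1)); set s := - B / (Q + 1) => Hs.
have BE : B = - s * (Q + 1) by rewrite /s; field; rewrite gt_eqF.
have : s ^+ 2 * (Q + 2) <= 0.
  rewrite -oppr_ge0; apply: le_trans Hs _; rewrite le_eqVlt.
  by apply/orP; left; apply/eqP; rewrite {1}BE; ring.
rewrite pmulr_lle0; last by rewrite ltr_wpDl.
move=> s2; have : s ^+ 2 == 0 by rewrite eq_le s2 sqr_ge0.
by rewrite sqrf_eq0 => /eqP s0; rewrite BE s0 oppr0 mul0r.
Qed.

(** * The tree *)

Section Tree.
Context {R : realType}.
Variables (m d : nat) (k : nat -> nat) (T : nat -> R) (tau : R) (b c : nat -> R).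
Local Notation mu := (@lebesgue_measure R).
Hypothesis dm : (d < m)%N.
Hypothesis k1 : k 1%N = 0%N.
Hypothesis kd : forall j, (2 <= j <= m)%N -> (1 <= k j <= d)%N.
Hypothesis tau0 : 0 <= tau.
Hypothesis tauT : forall j, (1 <= j <= m)%N -> tau < T j.
Implicit Types (j nu : nat) (y Dy v Dv E h : nat -> R -> R) (p e : nat -> R).

Local Notation ydel := (ydel k T tau).
Local Notation ell := (ell k T tau b c).
Local Notation lj := (lj d T tau).
Local Notation W21_tree := (W21_tree m T tau).
Local Notation conds := (conds m d k T tau).
Local Notation Jfun := (Jfun m k T tau b c).

Local Notation square_integrable E :=
  (forall j, (1 <= j <= m)%N -> L2 0 (T j) (E j)).
Local Notation node_continuous y :=
  (forall j, (2 <= j <= m)%N -> y j 0 = y (k j) (T (k j))).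

(* [tell m k T tau b c y Dy] is convertible to [delay_adjoint (ell y Dy)]. *)
Definition delay_adjoint E j t : R :=
  if t < T j - tau then c j * E j (t + tau)
  else \sum_(nu <- iota 1 m | k nu == j) c nu * E nu (t + tau - T j).

Let T0 j : (1 <= j <= m)%N -> 0 < T j.
Proof. by move=> /tauT; exact: le_lt_trans. Qed.

Let Ttau j : (1 <= j <= m)%N -> 0 <= T j - tau.
Proof. by move=> /tauT/ltW; rewrite subr_ge0. Qed.

Let lo_le0 j : lo tau j <= 0.
Proof. by rewrite /lo; case: ifP; rewrite // oppr_le0. Qed.

Lemma lj_gt0 j : (1 <= j <= m)%N -> 0 < lj j.
Proof. by move=> jm; rewrite /Defs.lj; case: ifP => _; rewrite ?T0// subr_gt0 tauT. Qed.

Lemma lj_leT j : lj j <= T j.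
Proof. by rewrite /Defs.lj; case: ifP => // _; rewrite gerBl. Qed.

Let k_edge j : (2 <= j <= m)%N -> (1 <= k j <= m)%N.
Proof. by move=> /kd; lia. Qed.

(** * Regrouping sums over edges by their starting vertex *)

(** Edge 1 is the only one that leaves the root; every other edge leaves exactly one internal
    vertex. *)
Lemma sum_children (G : nat -> R) :
  \sum_(nu <- iota 1 m) G nu =
  G 1%N + \sum_(j <- iota 1 d) \sum_(nu <- iota 1 m | k nu == j) G nu.
Proof.
have m1 : (0 < m)%N by lia.
rewrite (exchange_big_dep predT)//=.
rewrite -(prednK m1) /= !big_cons/= k1.
have -> : \sum_(j <- iota 1 d | 0%N == j) G 1%N = 0.
  rewrite big_seq_cond big_pred0// => j; rewrite mem_iota.
  by apply/negbTE/negP => /andP[+ /eqP]; lia.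
rewrite add0r; congr (_ + _).
rewrite [LHS]big_seq [RHS]big_seq; apply: eq_bigr => nu; rewrite mem_iota => nuM.
have nuM' : (2 <= nu <= m)%N by lia.
have := kd nuM' => knu.
rewrite (big_rem (k nu))/=; last by rewrite mem_iota; lia.
rewrite eqxx big_seq_cond big_pred0 ?addr0// => j.
apply/negbTE/negP => /andP[+ /eqP kj]; rewrite mem_rem_uniq ?iota_uniq// inE/= kj.
by rewrite eqxx.
Qed.

Lemma sum_internal (S : nat -> R) :
  \sum_(j <- iota 1 m) (if (j <= d)%N then S j else 0) = \sum_(j <- iota 1 d) S j.
Proof.
rewrite -(subnKC (ltnW dm)) iotaD big_cat/= [X in _ + X]big_seq [X in _ + X]big1; last first.
  by move=> j; rewrite mem_iota; case: ifP => //; lia.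
rewrite addr0 big_seq [RHS]big_seq; apply: eq_bigr => j; rewrite mem_iota.
by case: ifP => //; lia.
Qed.

Lemma eq_sum_edge (F G : nat -> R) : (forall j, (1 <= j <= m)%N -> F j = G j) ->
  \sum_(j <- iota 1 m) F j = \sum_(j <- iota 1 m) G j.
Proof.
move=> FG; rewrite big_seq [RHS]big_seq; apply: eq_bigr => j; rewrite mem_iota => jm.
by apply: FG; lia.
Qed.

(** * Regularity of the delayed terms *)

Lemma ydel_wderiv y Dy j : W21_tree y Dy ->
  node_continuous y ->
  (1 <= j <= m)%N -> is_wderiv 0 (T j) (ydel y j) (ydel Dy j).
Proof.
move=> W C jm; have Wj := W _ jm.
have [j1|j1] := eqVneq j 1%N.
  rewrite /Defs.ydel j1 eqxx; apply: (wderiv_shift (s := - tau)).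
  rewrite j1 in Wj; apply: wderiv_sub Wj.
  - by rewrite /lo eqxx add0r.
  - by rewrite lerD2r ltW// T0//; lia.
  - by rewrite gerDl oppr_le0.
have j2 : (2 <= j <= m)%N by lia.
have kj := k_edge j2.
have jT := ltW (tauT jm).
rewrite /Defs.ydel (negbTE j1); apply: wderiv_glue => //.
(* At [t = tau] the two pieces have the values $y_{k_j}(T_{k_j})$ and $y_j(0)$: condition (C) is
   what makes the delayed function absolutely continuous. *)
- by rewrite subrr add0r C.
- apply: (wderiv_eq tau0 (f := fun t => y (k j) (t + (- tau + T (k j))))
    (g := fun t => Dy (k j) (t + (- tau + T (k j))))).
  + by move=> t _; rewrite addrA.
  + by move=> t _; rewrite addrA.
  apply: wderiv_shift; apply: wderiv_sub (W _ kj).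
  + by rewrite add0r addrC (le_trans (lo_le0 _)) ?Ttau.
  + by rewrite lerD2r.
  + by rewrite addrA subrr add0r.
- apply: (wderiv_shift (s := - tau)); apply: wderiv_sub Wj.
  + by rewrite subrr lo_le0.
  + by rewrite lerD2r.
  + by rewrite gerDl oppr_le0.
Qed.

Lemma W21_0T y Dy j : W21_tree y Dy -> (1 <= j <= m)%N -> is_wderiv 0 (T j) (y j) (Dy j).
Proof.
move=> W jm; apply: wderiv_sub (W _ jm) => //; exact/ltW/T0.
Qed.

Lemma ell_L2 y Dy j : W21_tree y Dy ->
  node_continuous y ->
  (1 <= j <= m)%N -> L2 0 (T j) (ell y Dy j).
Proof.
move=> W C jm; have Tj := ltW (T0 jm); have Wj := W21_0T W jm.
apply: L2D; first apply: L2D.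
- exact: wderiv_L2D Wj.
- exact/L2Z/(wderiv_L2 _ Wj).
- by apply/L2Z/(wderiv_L2 _ (ydel_wderiv W C jm)).
Qed.

Lemma delay_adjoint_L2 E j : square_integrable E ->
  (1 <= j <= m)%N -> L2 0 (lj j) (delay_adjoint E j).
Proof.
move=> LE jm; rewrite /delay_adjoint.
have LEj : L2 0 (T j - tau) (fun t => c j * E j (t + tau)).
  apply/L2Z/L2_shift; rewrite subrK; apply: L2_sub (LE _ jm) => //.
  by rewrite add0r.
rewrite /Defs.lj; case: ifP => jd.
  apply: L2_glue => //; [exact: Ttau|by rewrite gerBl|].
  rewrite (_ : (fun t => _) = (fun t => \sum_(nu <- iota 1 m | (k nu == j) && (1 <= nu <= m)%N)
     c nu * E nu (t + tau - T j))).
    apply: L2_sum => nu /andP[_ nm].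
    apply: L2Z; apply: (L2_eq (f := fun t => E nu (t + (tau - T j)))).
      by move=> t _; rewrite addrA.
    apply: L2_shift; apply: L2_sub (LE _ nm).
      by rewrite addrA subrK subrr.
    by rewrite addrC subrK ltW// tauT.
  apply/funext => t; rewrite big_seq_cond [RHS]big_seq_cond.
  by apply: eq_bigl => nu; rewrite mem_iota; lia.
apply: L2_glue => //; first exact: Ttau.
(* On a boundary edge the second branch is met only at the end point $T_j-\tau$, so a constant with
   the right value there can replace it. *)
set F := fun t => _; apply: (L2_eq (f := fun=> F (T j - tau))); last exact: L2_cst.
by move=> t; rewrite -eq_le => /eqP <-.
Qed.

Lemma target_deriv0 v Dv j : W21_tree v Dv -> conds (fun=> 0) v -> (d < j <= m)%N ->
  aeq (T j - tau) (T j) (Dv j) (fun=> 0).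
Proof.
move=> W [_ [_ Z]] jm.
have jm' : (1 <= j <= m)%N by lia.
have jtT : T j - tau <= T j by rewrite gerBl.
have Wj := wderiv_sub (Ttau jm') jtT (lexx _) (W21_0T W jm').
apply: ae0_itg => //; first exact: (wderiv_L2D Wj).1.
have jd : (d + 1 <= j <= m)%N by lia.
move=> t tab; have := wderivE Wj tab.
by rewrite (Z _ jd)// (Z _ jd) ?lexx ?jtT// add0r => <-.
Qed.

(** * Transposing the delay onto the edges where the arguments lie *)

(** This isolates the times at which the delayed argument lies off edge [j]: on the parent edge, or
    in the prehistory if [j] is 1. *)
Definition delayed_part E v j := itg 0 tau (fun t => E j t * ydel v j t).

Lemma delayed_part_root E v : conds (fun=> 0) v -> (1 <= m)%N -> delayed_part E v 1 = 0.
Proof.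
move=> [_ [P _]] m1; transitivity (itg 0 tau (fun=> 0)); last by rewrite itg_cst// mul0r.
apply: itg_eq => t /andP[t0 tt]; rewrite /Defs.ydel eqxx P ?mulr0//.
by rewrite lerBrDl subrr t0/= subr_le0 tt.
Qed.

(** Substitute $s=t-\tau+T_{k_j}$. The integrands are compared on the open interval because at
    [t = tau] the delay convention has already switched to edge [j]. *)
Lemma delayed_part_child E v Dv j : W21_tree v Dv -> conds (fun=> 0) v ->
  square_integrable E -> (2 <= j <= m)%N ->
  delayed_part E v j =
  itg (T (k j) - tau) (T (k j)) (fun s => E j (s + tau - T (k j)) * v (k j) s).
Proof.
move=> W [C _] LE j2; have jm : (1 <= j <= m)%N by lia.
have kj := k_edge j2.
have j1 : (j == 1%N) = false by lia.
rewrite /delayed_part.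
have := @itg_shift _ (- tau + T (k j)) 0 tau (fun s => E j (s + tau - T (k j)) * v (k j) s).
rewrite add0r addrA subrr add0r [- tau + _]addrC => <-; last first.
  apply: L2M.
    apply: (L2_eq (f := fun t => E j (t + (tau - T (k j))))) => [t _|]; first by rewrite addrA.
    apply: L2_shift; apply: L2_sub (LE _ jm).
      by rewrite addrA subrK subrr.
    by rewrite addrC subrK ltW// tauT.
  have WT := W21_0T W kj.
  apply: L2_sub (wderiv_L2 _ WT) => //; [exact: Ttau|exact/ltW/T0].
have LEj := LE _ jm.
have Ly := wderiv_L2 (ltW (T0 jm)) (ydel_wderiv W C jm).
have tT := ltW (tauT jm).
have LL : L1 0 tau (fun t => E j t * ydel v j t).
  by apply: L2M; apply: L2_sub; [exact: lexx|exact: tT| |exact: lexx|exact: tT|].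
have e t : E j (t + (T (k j) - tau) + tau - T (k j)) = E j t by congr (E j _); ring.
have agree t : 0 < t < tau -> E j t * ydel v j t =
    E j (t + (T (k j) - tau) + tau - T (k j)) * v (k j) (t + (T (k j) - tau)).
  move=> /andP[_ tt]; rewrite e /Defs.ydel j1 tt; congr (_ * v _ _); ring.
apply: itg_aeq => //; last exact: eq_oo_aeq.
apply: L2M; first by apply: (L2_eq (f := E j)) => [t _|]; [rewrite e|exact: L2_sub LEj].
apply: L2_shift; have WT := W21_0T W kj.
apply: L2_sub (wderiv_L2 _ WT) => //.
- by rewrite add0r Ttau.
- by rewrite addrCA subrr addr0.
- exact/ltW/T0.
Qed.

Lemma ell_pairing_edge E v Dv j : W21_tree v Dv -> conds (fun=> 0) v ->
  square_integrable E -> (1 <= j <= m)%N ->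
  itg 0 (T j) (fun t => E j t * ell v Dv j t) =
  itg 0 (lj j) (fun t => E j t * Dv j t + b j * E j t * v j t) +
  c j * delayed_part E v j +
  c j * itg 0 (T j - tau) (fun t => E j (t + tau) * v j t).
Proof.
move=> W H LE jm; have [C [P Z]] := H.
have LEj := LE _ jm; have Tj := ltW (T0 jm); have tT := ltW (tauT jm).
have Wj := W21_0T W jm; have Wd := ydel_wderiv W C jm.
have [LD Lv] := (wderiv_L2D Wj, wderiv_L2 Tj Wj).
have Ld := wderiv_L2 Tj Wd.
have L1a : L1 0 (T j) (fun t => E j t * Dv j t + b j * E j t * v j t).
  by apply: L1D; apply: L2M => //; exact: L2Z.
have L1b := L2M LEj Ld.
have -> : itg 0 (T j) (fun t => E j t * ell v Dv j t) =
    itg 0 (T j) (fun t => E j t * Dv j t + b j * E j t * v j t) +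
    c j * itg 0 (T j) (fun t => E j t * ydel v j t).
  rewrite -itgZ// -itgD//; last exact: L1Z.
  by apply: itg_eq => t _; rewrite /Defs.ell; ring.
rewrite (itg_split tau0 tT L1b) mulrDr addrA; congr (_ + c j * _ + c j * _).
  (* On a boundary edge $v_j=0$ and $v_j'=0$ a.e. on the last stretch, which shortens the interval
     from $T_j$ to $l_j$. *)
  rewrite /Defs.lj; case: ifPn => // jd.
  have jtT : T j - tau <= T j by rewrite gerBl.
  rewrite (itg_split (Ttau jm) jtT L1a).
  rewrite [X in _ + X](@itg_aeq _ _ _ _ (fun=> 0)) ?itg_cst ?mul0r ?addr0//.
  - by apply: L1_sub L1a => //; exact: Ttau.
  - exact: L1_cst.
  have jm' : (d < j <= m)%N by lia.
  apply: (@filterS _ _ (ae_filter_ringOfSetsType mu) _ _ _ (target_deriv0 W H jm')) => t + tab.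
  by move=> /(_ tab) ->; rewrite (Z j) ?mulr0 ?addr0//; lia.
have := @itg_shift _ tau 0 (T j - tau) (fun t => E j t * ydel v j t).
rewrite add0r subrK => <-; last by apply: L1_sub L1b.
apply: itg_eq => t /andP[t0 _]; congr (_ * _).
rewrite /Defs.ydel addrK; case: eqP => [->//|_].
by rewrite ltNge lerDr t0.
Qed.

(** Splitting at $T_j-\tau$ separates the part of the adjoint coming from edge [j] itself from the
    part coming from its children. *)
Lemma delay_adjoint_pairing E v Dv j : W21_tree v Dv ->
  square_integrable E -> (1 <= j <= m)%N ->
  itg 0 (lj j) (fun t => delay_adjoint E j t * v j t) =
  c j * itg 0 (T j - tau) (fun t => E j (t + tau) * v j t) +
  (if (j <= d)%N then \sum_(nu <- iota 1 m | k nu == j)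
     c nu * itg (T j - tau) (T j) (fun s => E nu (s + tau - T j) * v j s) else 0).
Proof.
move=> W LE jm; have Tj := ltW (T0 jm).
have Lv := wderiv_L2 Tj (W21_0T W jm).
have Lq := delay_adjoint_L2 LE jm.
have LT : T j - tau <= lj j by rewrite /Defs.lj; case: ifP => // _; rewrite gerBl.
have LLv : L2 0 (lj j) (v j) by apply: L2_sub Lv => //; exact: lj_leT.
have L1qv := L2M Lq LLv.
rewrite (itg_split (Ttau jm) LT L1qv); congr (_ + _).
  have LEt : L1 0 (T j - tau) (fun t => E j (t + tau) * v j t).
    apply: L2M; last by apply: L2_sub Lv => //; rewrite gerBl.
    apply: L2_shift; rewrite subrK; apply: L2_sub (LE _ jm) => //.
    by rewrite add0r.
  rewrite -itgZ//; apply: itg_aeq.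
  - by apply: L1_sub L1qv.
  - exact: L1Z.
  - by apply: eq_oo_aeq => t /andP[_ tt]; rewrite /delay_adjoint tt mulrA.
move: LT; rewrite /Defs.lj; case: ifP => jd LT; last by rewrite itg_point.
transitivity (itg (T j - tau) (T j) (fun s => \sum_(nu <- iota 1 m | (k nu == j) && (1 <= nu <= m)%N)
     c nu * (E nu (s + tau - T j) * v j s))).
  apply: itg_eq => t /andP[tt _]; rewrite /delay_adjoint ltNge tt/= mulr_suml.
  rewrite big_seq_cond [RHS]big_seq_cond; apply: eq_big => [nu|nu _]; last by rewrite mulrA.
  by rewrite mem_iota; lia.
have iotaE F : \sum_(nu <- iota 1 m | k nu == j) F nu =
  \sum_(nu <- iota 1 m | (k nu == j) && (1 <= nu <= m)%N) F nu :> R.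
  rewrite big_seq_cond [RHS]big_seq_cond; apply: eq_bigl => nu; rewrite mem_iota; lia.
rewrite iotaE.
have LF nu : (1 <= nu <= m)%N -> L1 (T j - tau) (T j) (fun s => E nu (s + tau - T j) * v j s).
  move=> nm; apply: L2M; last by apply: L2_sub Lv => //; exact: Ttau.
  apply: (L2_eq (f := fun t => E nu (t + (tau - T j)))) => [t _|]; first by rewrite addrA.
  apply: L2_shift; apply: L2_sub (LE _ nm).
    by rewrite addrA subrK subrr.
  by rewrite addrC subrK ltW// tauT.
rewrite itg_sum//; first by apply: eq_bigr => nu /andP[_ nm]; rewrite itgZ//; exact: LF.
by move=> nu /andP[_ nm]; apply/L1Z/LF.
Qed.

(** The same-edge delay terms agree edge by edge. The delayed part of each child equals one summand
    in the adjoint on its parent, and the root has no delayed part, so grouping by parent finishes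
    the match. *)
Lemma ell_pairing E v Dv : W21_tree v Dv -> conds (fun=> 0) v ->
  square_integrable E ->
  \sum_(j <- iota 1 m) itg 0 (T j) (fun t => E j t * ell v Dv j t) =
  \sum_(j <- iota 1 m) itg 0 (lj j) (fun t => E j t * Dv j t +
     (b j * E j t + delay_adjoint E j t) * v j t).
Proof.
move=> W H LE.
have m1 : (1 <= m)%N by lia.
transitivity (\sum_(j <- iota 1 m) (itg 0 (lj j) (fun t => E j t * Dv j t + b j * E j t * v j t)
   + c j * itg 0 (T j - tau) (fun t => E j (t + tau) * v j t)) +
  \sum_(j <- iota 1 m) c j * delayed_part E v j).
  rewrite -big_split/=; apply: eq_sum_edge => j jm.
  by rewrite (ell_pairing_edge W H LE jm); ring.
rewrite [X in _ + X]sum_children (delayed_part_root _ H m1) mulr0 add0r -sum_internal -big_split/=.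
apply: eq_sum_edge => j jm.
have Tj := ltW (T0 jm).
have LEj : L2 0 (lj j) (E j) by apply: L2_sub (LE _ jm) => //; exact: lj_leT.
have Wj := wderiv_sub (lexx _) (ltW (lj_gt0 jm)) (lj_leT j) (W21_0T W jm).
have [LD Lv] := (wderiv_L2D Wj, wderiv_L2 (ltW (lj_gt0 jm)) Wj).
transitivity (itg 0 (lj j) (fun t => E j t * Dv j t + b j * E j t * v j t) +
  itg 0 (lj j) (fun t => delay_adjoint E j t * v j t)); last first.
  rewrite -itgD.
  - by apply: itg_eq => t _; ring.
  - by apply: L1D; apply: L2M => //; exact: L2Z.
  - by apply: L2M => //; exact: delay_adjoint_L2.
rewrite (delay_adjoint_pairing W LE jm) addrA; congr (_ + _).
case: ifP => // jd; rewrite big_seq_cond [RHS]big_seq_cond; apply: eq_bigr => nu.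
rewrite mem_iota => /andP[nm /eqP knu]; congr (_ * _).
rewrite (delayed_part_child W H LE) ?knu//.
have nu1 : nu <> 1%N by move=> n1; move: knu; rewrite n1 k1; lia.
by lia.
Qed.


(** * The functional and its first variation *)

Lemma Jfun_itg y Dy : W21_tree y Dy ->
  node_continuous y ->
  Jfun y Dy = (\sum_(j <- iota 1 m) itg 0 (T j) (fun t => ell y Dy j t ^+ 2))%:E.
Proof.
move=> W C; rewrite /Defs.Jfun -sumEFin.
rewrite big_seq [RHS]big_seq; apply: eq_bigr => j; rewrite mem_iota => jm.
have jm' : (1 <= j <= m)%N by lia.
have [_ L] := ell_L2 W C jm'; rewrite EFin_itg//.
have mL : measurable_fun `[0, T j] (fun t => (ell y Dy j t ^+ 2)%:E).
  exact: measurable_int L.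
rewrite integral_itv_obnd_cbnd.
  rewrite integral_itv_bndo_bndc//.
  by apply: measurable_funS mL => //; apply: subset_itv; rewrite bnd_simp.
by apply: measurable_funS mL => //; apply: subset_itv; rewrite bnd_simp.
Qed.

Definition bilin y Dy v Dv :=
  \sum_(j <- iota 1 m) itg 0 (T j) (fun t => ell y Dy j t * ell v Dv j t).

Lemma ell_add s y Dy v Dv j t :
  ell (fun j t => y j t + s * v j t) (fun j t => Dy j t + s * Dv j t) j t =
  ell y Dy j t + s * ell v Dv j t.
Proof. by rewrite /Defs.ell /Defs.ydel; case: ifP => _; [|case: ifP => _]; ring. Qed.

Lemma bilin_expand s y Dy v Dv : W21_tree y Dy -> W21_tree v Dv ->
  node_continuous y ->
  node_continuous v ->
  Jfun (fun j t => y j t + s * v j t) (fun j t => Dy j t + s * Dv j t) =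
  (bilin y Dy y Dy + 2 * s * bilin y Dy v Dv + s ^+ 2 * bilin v Dv v Dv)%:E.
Proof.
move=> W Wv C Cv.
rewrite Jfun_itg; last 2 first.
- by move=> j jm; apply: wderivD; [exact: W|apply: wderivZ; exact: Wv].
- by move=> j jm; rewrite C// Cv.
congr EFin; rewrite /bilin !mulr_sumr -!big_split/=; apply: eq_sum_edge => j jm.
have [L Lv] := (ell_L2 W C jm, ell_L2 Wv Cv jm).
have L1yv := L2M L Lv.
rewrite -!itgZ//; last exact: L2M.
rewrite -itgD; [|exact: L2M|exact: L1Z].
rewrite -itgD; [|by apply: L1D; [exact: L2M|exact: L1Z]|by apply/L1Z/L2M].
by apply: itg_eq => t _; rewrite ell_add; ring.
Qed.

Lemma bilin_ge0 v Dv : 0 <= bilin v Dv v Dv.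
Proof. by apply: sumr_ge0 => j _; apply: itg_ge0 => t _; rewrite -expr2 sqr_ge0. Qed.

Lemma VP_stationary phi y Dy : W21_tree y Dy ->
  solves_VP m d k T tau b c phi y Dy <->
  conds phi y /\ forall v Dv, W21_tree v Dv -> conds (fun=> 0) v -> bilin y Dy v Dv = 0.
Proof.
move=> W.
have Jy : conds phi y -> Jfun y Dy = (bilin y Dy y Dy)%:E.
  by move=> [C _]; rewrite (Jfun_itg W C).
split=> -[H].
  move=> Hmin; split=> // v Dv Wv Hv; have [C [P Z]] := H; have [Cv [Pv Zv]] := Hv.
  apply: (@quadratic_min _ _ (bilin v Dv v Dv)); first exact: bilin_ge0.
  move=> s.
  have /= := Hmin (fun j t => y j t + s * v j t) (fun j t => Dy j t + s * Dv j t).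
  rewrite bilin_expand// Jy// lee_fin -addrA lerDl; apply.
  - by move=> j jm; apply: wderivD; [exact: W|apply: wderivZ; exact: Wv].
  - split; first by move=> j jm; rewrite C// Cv.
    split; first by move=> t tt; rewrite P// Pv// mulr0 addr0.
    by move=> j jm t tt; rewrite (Z j)// (Zv j)// mulr0 addr0.
move=> B0; split=> // z Dz Wz Hz; have [C [P Z]] := H; have [Cz [Pz Zz]] := Hz.
(* With $v=z-y$ the cross term vanishes, so $\mathcal J(z)=\mathcal J(y)+\mathcal J(v)$; this is the
   expansion at $s=1$. *)
pose v j t := z j t + -1 * y j t; pose Dv j t := Dz j t + -1 * Dy j t.
have Wv : W21_tree v Dv.
  by move=> j jm; apply: wderivD; [exact: Wz|apply: wderivZ; exact: W].
have Hv : conds (fun=> 0) v.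
  split; first by move=> j jm; rewrite /v C// Cz.
  split; first by move=> t tt; rewrite /v P// Pz// mulN1r subrr.
  by move=> j jm t tt; rewrite /v (Z j)// (Zz j)// mulr0 addr0.
have -> : z = (fun j t => y j t + 1 * v j t).
  by apply/funext => j; apply/funext => t; rewrite /v; ring.
have -> : Dz = (fun j t => Dy j t + 1 * Dv j t).
  by apply/funext => j; apply/funext => t; rewrite /Dv; ring.
rewrite bilin_expand//; last exact: Hv.1.
rewrite Jy// (B0 v Dv)// mulr0 addr0 lee_fin lerDl mulr_ge0 ?sqr_ge0//.
exact: bilin_ge0.
Qed.

(** * Weak form and boundary terms *)

(** This is the coefficient $q_j$ of the weak form. *)
Definition weak_coef y Dy j t : R :=
  b j * ell y Dy j t + delay_adjoint (ell y Dy) j t.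

Lemma weak_coef_L2 y Dy j : W21_tree y Dy ->
  node_continuous y ->
  (1 <= j <= m)%N -> L2 0 (lj j) (weak_coef y Dy j).
Proof.
move=> W C jm; apply: L2D; last first.
  by apply: delay_adjoint_L2 => // i im; exact: ell_L2.
by apply: L2Z; apply: L2_sub (ell_L2 W C jm) => //; exact: lj_leT.
Qed.

Lemma child_internal j nu : (1 <= j)%N -> (1 <= nu <= m)%N -> k nu = j -> (2 <= nu <= m)%N.
Proof.
move=> j1 nm knu; have nu1 : nu <> 1%N by move=> n1; move: knu; rewrite n1 k1; lia.
by lia.
Qed.

(** Think of [p] as values at the starts of edges and of [e] as values at the vertices: the
    hypotheses express continuity at the internal vertices and a zero at the root. *)
Lemma sum_nodes (G : nat -> R) e p : p 1%N = 0 ->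
  (forall j, (2 <= j <= m)%N -> p j = e (k j)) ->
  \sum_(nu <- iota 1 m) G nu * p nu =
  \sum_(j <- iota 1 d) e j * \sum_(nu <- iota 1 m | k nu == j) G nu.
Proof.
move=> p1 pe; rewrite sum_children p1 mulr0 add0r.
rewrite big_seq [RHS]big_seq; apply: eq_bigr => j; rewrite mem_iota => jd.
rewrite mulr_sumr big_seq_cond [RHS]big_seq_cond; apply: eq_bigr => nu.
rewrite mem_iota => /andP[nm /eqP knu]; rewrite pe ?knu; first by rewrite mulrC.
by apply: (child_internal _ _ knu); lia.
Qed.

(** At $l_j$ a boundary edge contributes nothing because $v_j(T_j-\tau)=0$. The terms at the starts
    of edges are collected at the vertices by continuity of $v$. *)
Lemma weak_form_ibp E q v Dv :
  (forall j, (1 <= j <= m)%N -> is_wderiv 0 (lj j) (E j) (q j)) ->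
  W21_tree v Dv -> conds (fun=> 0) v ->
  \sum_(j <- iota 1 m) itg 0 (lj j) (fun t => E j t * Dv j t + q j t * v j t) =
  \sum_(j <- iota 1 d)
    v j (T j) * (E j (T j) - \sum_(nu <- iota 1 m | k nu == j) E nu 0).
Proof.
move=> WE Wv [C [P Z]].
transitivity (\sum_(j <- iota 1 m) (E j (lj j) * v j (lj j)) - \sum_(j <- iota 1 m) E j 0 * v j 0).
  rewrite -sumrB; apply: eq_sum_edge => j jm.
  have lj0 := ltW (lj_gt0 jm).
  exact: (wderiv_parts lj0 (WE _ jm) (wderiv_sub (lexx _) lj0 (lj_leT _) (W21_0T Wv jm))).
rewrite (@sum_nodes (fun j => E j 0) (fun j => v j (T j)) (fun j => v j 0))//; last first.
  by apply: P; rewrite oppr_le0 tau0 lexx.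
under [RHS]eq_bigr do rewrite mulrBr.
rewrite sumrB; congr (_ - _); rewrite -sum_internal; apply: eq_sum_edge => j jm.
rewrite /Defs.lj; case: ifPn => jd; first by rewrite mulrC.
by rewrite (Z j) ?mulr0 ?lexx ?gerBl//; lia.
Qed.

(** The Kirchhoff expression is the defect of $\ell y$ across the vertex: at the start of each child
    the value is $y_j(T_j)$ and the delayed value is $y_j(T_j-\tau)$, both common to all
    children. *)
Lemma kirchhoffE phi y D1 j : conds phi y -> (1 <= j <= d)%N ->
  ell y D1 j (T j) - \sum_(nu <- iota 1 m | k nu == j) ell y D1 nu 0 =
  D1 j (T j) - \sum_(nu <- iota 1 m | k nu == j) D1 nu 0
     + (b j - \sum_(nu <- iota 1 m | k nu == j) b nu) * y j (T j)
     + (c j - \sum_(nu <- iota 1 m | k nu == j) c nu) * y j (T j - tau).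
Proof.
move=> [C _] jd; have jm : (1 <= j <= m)%N by lia.
have -> : ell y D1 j (T j) = D1 j (T j) + b j * y j (T j) + c j * y j (T j - tau).
  congr (_ + c j * _); rewrite /Defs.ydel; case: eqP => [->//|_].
  by rewrite ltNge ltW// tauT.
have -> : \sum_(nu <- iota 1 m | k nu == j) ell y D1 nu 0 =
    \sum_(nu <- iota 1 m | k nu == j) D1 nu 0 +
    (\sum_(nu <- iota 1 m | k nu == j) b nu) * y j (T j) +
    (\sum_(nu <- iota 1 m | k nu == j) c nu) * y j (T j - tau).
  rewrite !mulr_suml -!big_split/= big_seq_cond [RHS]big_seq_cond.
  apply: eq_bigr => nu; rewrite mem_iota => /andP[nm /eqP knu].
  have nu2 : (2 <= nu <= m)%N by apply: (child_internal _ _ knu); lia.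
  rewrite /Defs.ell C// knu; congr (_ + _ * _).
  have n1 : (nu == 1%N) = false by lia.
  (* For [tau = 0] the convention selects the child edge at time 0, and continuity brings the value
     back to the parent. *)
  rewrite /Defs.ydel n1; case: ltP => [_|t0]; first by rewrite knu; congr (y j _); ring.
  have -> : tau = 0 by apply/eqP; rewrite eq_le t0 tau0.
  by rewrite !subr0 C// knu.
ring.
Qed.

Lemma B_stationary phi y Dy : W21_tree y Dy -> solves_B m d k T tau b c phi y Dy ->
  forall v Dv, W21_tree v Dv -> conds (fun=> 0) v -> bilin y Dy v Dv = 0.
Proof.
move=> W [D1 [D2 [WW [H [ode kir]]]]] v Dv Wv Hv; have [C _] := H.
have LE j : (1 <= j <= m)%N -> L2 0 (T j) (ell y Dy j) by exact: ell_L2.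
(* The differential equation says exactly that the weak derivative of $\ell_j y$ is $q_j$. *)
have Wq j : (1 <= j <= m)%N -> is_wderiv 0 (lj j) (ell y D1 j) (weak_coef y Dy j).
  move=> jm; have [w [Ww aew]] := ode _ jm.
  apply: wderiv_aeq Ww; first exact: weak_coef_L2.
  apply: aeq_oo; apply: (@filterS _ _ (ae_filter_ringOfSetsType mu) _ _ _ aew) => t H0 tl.
  have : t \in `]0, lj j[ by rewrite in_itv.
  move=> /H0 {}H0; apply/eqP; rewrite eq_sym -subr_eq0; apply/eqP; rewrite -H0 /weak_coef.
  have -> : tell m k T tau b c y Dy j t = delay_adjoint (ell y Dy) j t by [].
  ring.
rewrite /bilin (ell_pairing Wv Hv LE).
transitivity (\sum_(j <- iota 1 m) itg 0 (lj j)
    (fun t => ell y D1 j t * Dv j t + weak_coef y Dy j t * v j t)).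
  apply: eq_sum_edge => j jm.
  have lj0 := ltW (lj_gt0 jm).
  have Wvj := wderiv_sub (lexx _) lj0 (lj_leT _) (W21_0T Wv jm).
  have [LD Lv] := (wderiv_L2D Wvj, wderiv_L2 lj0 Wvj).
  have Lq := weak_coef_L2 W C jm.
  apply: itg_aeq.
  - apply: L1D; apply: L2M => //.
    by apply: L2_sub (LE _ jm) => //; exact: lj_leT.
  - apply: L1D; apply: L2M => //; exact: wderiv_L2 (Wq _ jm).
  have := wderiv_unique lj0 (WW _ jm).1
    (wderiv_sub (lexx _) lj0 (lj_leT _) (W21_0T W jm)).
  apply: (@filterS _ _ (ae_filter_ringOfSetsType mu)) => t + tl => /(_ tl) D1E.
  by rewrite [ell y D1 j t]/Defs.ell D1E.
rewrite (weak_form_ibp Wq Wv Hv) big_seq big1// => j; rewrite mem_iota => jd.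
have jd' : (1 <= j <= d)%N by lia.
by rewrite (kirchhoffE _ H jd') kir// mulr0.
Qed.

(* [p j] and [h j] prescribe v_j(0) and v_j' on [0, l_j]; v_j is constant beyond l_j. *)
Lemma test_function p h : p 1%N = 0 ->
  (forall j, (1 <= j <= m)%N -> L2 0 (lj j) (h j)) ->
  (forall j, (2 <= j <= m)%N -> p j = p (k j) + itg 0 (lj (k j)) (h (k j))) ->
  (forall j, (d < j <= m)%N -> p j + itg 0 (lj j) (h j) = 0) ->
  exists v Dv, [/\ W21_tree v Dv, conds (fun=> 0) v &
    forall j, (1 <= j <= m)%N -> v j 0 = p j /\ is_wderiv 0 (lj j) (v j) (h j)].
Proof.
move=> p1 Lh pk pd.
pose w j t := if t < lj j then p j + itg 0 t (h j) else p j + itg 0 (lj j) (h j).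
pose Dw j t := if t < lj j then h j t else 0.
(* The cut below 0 supplies the zero prehistory of edge 1, the only edge whose domain may reach
   below 0. *)
pose v j t := if t < 0 then 0 else w j t.
pose Dv j t := if t < 0 then 0 else Dw j t.
have w0 j : (1 <= j <= m)%N -> w j 0 = p j.
  by move=> jm; rewrite /w lj_gt0// itg_point addr0.
have Ww j : (1 <= j <= m)%N -> is_wderiv 0 (T j) (w j) (Dw j).
  move=> jm; apply: wderiv_glue => //.
  - exact/ltW/lj_gt0.
  - exact: lj_leT.
  - exact: wderiv_int (Lh _ jm).
  - apply/wderivP; split; first exact: L2_cst.
    by move=> t /andP[lt _]; rewrite itg_cst// mul0r addr0.
have vw j t : 0 <= t -> v j t = w j t by move=> t0; rewrite /v ltNge t0.
have Wv j : (1 <= j <= m)%N -> is_wderiv 0 (T j) (v j) (Dv j).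
  move=> jm; apply: wderiv_eq (Ww _ jm).
  - exact/ltW/T0.
  - by move=> t /andP[t0 _]; rewrite vw.
  - by move=> t /andP[t0 _]; rewrite /Dv ltNge t0.
have endE j : (1 <= j <= m)%N -> v j (T j) = p j + itg 0 (lj j) (h j).
  by move=> jm; rewrite vw ?(ltW (T0 jm))// /w ltNge lj_leT.
exists v, Dv; split.
- move=> j jm; rewrite /lo; have [j1|_] := eqVneq j 1%N; last exact: Wv.
  apply: wderiv_glue.
  + by rewrite oppr_le0.
  + exact/ltW/T0.
  + by rewrite w0// j1 p1.
  + apply/wderivP; split; first exact: L2_cst.
    by move=> t /andP[lt _]; rewrite itg_cst// mul0r addr0.
  + exact: Ww.
- split.
    move=> j j2; have jm : (1 <= j <= m)%N by lia.
    by rewrite (endE _ (k_edge j2)) -pk// (vw _ _ (lexx 0)) (w0 _ jm).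
  split.
    move=> t /andP[_ t0]; have [t0'|t0'] := ltP t 0; first by rewrite /v t0'.
    have -> : t = 0 by apply/eqP; rewrite eq_le t0 t0'.
    by rewrite vw// w0//; lia.
  move=> j jm t /andP[tt _].
  have jm' : (1 <= j <= m)%N by lia.
  have jd : (j <= d)%N = false by lia.
  have tl : lj j <= t by rewrite /Defs.lj jd.
  rewrite vw ?(le_trans (ltW (lj_gt0 jm')))// /w ltNge tl pd//; lia.
- move=> j jm; split; first by rewrite vw// w0.
  apply: (wderiv_eq (f := w j) (g := h j)); first exact/ltW/lj_gt0.
  + by move=> t /andP[t0 _]; rewrite vw.
  + by [].
  have lj0 := ltW (lj_gt0 jm).
  apply: wderiv_aeq (wderiv_sub (lexx _) lj0 (lj_leT _) (Ww _ jm)); first exact: Lh.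
  by apply: eq_oo_aeq => t /andP[_ tl]; rewrite /Dw tl.
Qed.

(** * From stationarity to the boundary value problem *)

(** For the test function $v$ with data [p] and [h], $p_j+\int h_j$ is $v_j(l_j)$. Integrating the
    primitive $F_j$ of $q_j$ by parts gives $\int q_jv_j=F_j(l_j)v_j(l_j)-\int F_jh_j$, so no
    regularity of $\ell_j y$ is needed. *)
Lemma stationary_test y Dy p h : W21_tree y Dy ->
  node_continuous y ->
  (forall v Dv, W21_tree v Dv -> conds (fun=> 0) v -> bilin y Dy v Dv = 0) ->
  p 1%N = 0 ->
  (forall j, (1 <= j <= m)%N -> L2 0 (lj j) (h j)) ->
  (forall j, (2 <= j <= m)%N -> p j = p (k j) + itg 0 (lj (k j)) (h (k j))) ->
  (forall j, (d < j <= m)%N -> p j + itg 0 (lj j) (h j) = 0) ->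
  \sum_(j <- iota 1 m)
    (itg 0 (lj j) (fun t => (ell y Dy j t - itg 0 t (weak_coef y Dy j)) * h j t) +
     itg 0 (lj j) (weak_coef y Dy j) * (p j + itg 0 (lj j) (h j))) = 0.
Proof.
move=> W C B0 p1 Lh pk pd.
have [v [Dv [Wv Hv vh]]] := test_function p1 Lh pk pd.
have LE j : (1 <= j <= m)%N -> L2 0 (T j) (ell y Dy j) by exact: ell_L2.
rewrite -[RHS](B0 v Dv Wv Hv) /bilin (ell_pairing Wv Hv LE).
apply: eq_sum_edge => j jm.
have lj0 := ltW (lj_gt0 jm).
have [vj0 Wh] := vh _ jm.
have Lq := weak_coef_L2 W C jm.
have WF := wderiv_int 0 Lq.
have LF : L2 0 (lj j) (fun t => itg 0 t (weak_coef y Dy j)).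
  by apply: L2_eq (wderiv_L2 lj0 WF) => t _; rewrite add0r.
have LEj : L2 0 (lj j) (ell y Dy j) by apply: L2_sub (LE _ jm) => //; exact: lj_leT.
have Lhj := Lh _ jm.
have Lv := wderiv_L2 lj0 Wh.
have -> : p j + itg 0 (lj j) (h j) = v j (lj j).
  by rewrite -vj0 -(wderivE Wh)// lexx lj0.
have := wderiv_parts lj0 WF Wh.
rewrite itg_point !add0r mul0r subr0 => <-.
have Wvj := wderiv_sub (lexx _) lj0 (lj_leT _) (W21_0T Wv jm).
have LD := wderiv_L2D Wvj.
rewrite -itgD.
- apply: itg_aeq.
  + apply: L1D; first apply: L2M => //.
      by apply: L2_eq (L2D LEj (L2Z (-1) LF)) => t _; rewrite mulN1r.
    apply: L1D; apply: L2M => //; exact: wderiv_L2 WF.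
  + by apply: L1D; apply: L2M.
  have := wderiv_unique lj0 Wh Wvj.
  apply: (@filterS _ _ (ae_filter_ringOfSetsType mu)) => t + tl => /(_ tl) ->.
  by rewrite /weak_coef; ring.
- apply: L2M => //.
  by apply: L2_eq (L2D LEj (L2Z (-1) LF)) => t _; rewrite mulN1r.
- by apply: L1D; apply: L2M => //; exact: wderiv_L2 WF.
Qed.

(** This is the du Bois-Reymond argument in $L_2$, on one edge at a time. *)
Lemma stationary_quasideriv y Dy j : W21_tree y Dy ->
  node_continuous y ->
  (forall v Dv, W21_tree v Dv -> conds (fun=> 0) v -> bilin y Dy v Dv = 0) ->
  (1 <= j <= m)%N ->
  exists C, aeq 0 (lj j) (ell y Dy j) (fun t => C + itg 0 t (weak_coef y Dy j)).
Proof.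
move=> W C B0 jm.
have lj0 := ltW (lj_gt0 jm).
have LE : L2 0 (lj j) (ell y Dy j) by apply: L2_sub (ell_L2 W C jm) => //; exact: lj_leT.
have WF := wderiv_int 0 (weak_coef_L2 W C jm).
set F := fun t => itg 0 t (weak_coef y Dy j).
have LF : L2 0 (lj j) F by apply: L2_eq (wderiv_L2 lj0 WF) => t _; rewrite add0r.
pose g t := ell y Dy j t - F t.
have Lg : L2 0 (lj j) g by apply: L2_eq (L2D LE (L2Z (-1) LF)) => t _; rewrite mulN1r.
pose M := itg 0 (lj j) g / lj j.
have LgM : L2 0 (lj j) (fun t => g t + - M) by apply: L2D => //; exact: L2_cst.
have gM0 : itg 0 (lj j) (fun t => g t + - M) = 0.
  rewrite itgD; [|exact: Lg.1|exact: L1_cst].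
  by rewrite itg_cst// subr0 mulNr /M divfK ?subrr// gt_eqF// lj_gt0.
pose h i := if i == j then (fun t => g t + - M) else (fun=> 0).
have h0 i : (1 <= i <= m)%N -> itg 0 (lj i) (h i) = 0.
  move=> im; rewrite /h; case: eqP => [->//|_].
  by rewrite itg_cst ?mul0r// ltW// lj_gt0.
have Lh i : (1 <= i <= m)%N -> L2 0 (lj i) (h i).
  by move=> im; rewrite /h; case: eqP => [->//|_]; exact: L2_cst.
have := @stationary_test y Dy (fun=> 0) h W C B0 erefl Lh.
have H1 i : (2 <= i <= m)%N -> 0 = 0 + itg 0 (lj (k i)) (h (k i)).
  by move=> im; rewrite h0 ?addr0//; exact: k_edge.
have H2 i : (d < i <= m)%N -> 0 + itg 0 (lj i) (h i) = 0.
  by move=> im; rewrite h0 ?addr0//; lia.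
move=> /(_ H1 H2).
rewrite (big_rem j)/=; last by rewrite mem_iota; lia.
rewrite [X in _ + X]big_seq big1 ?addr0; last first.
  move=> i; rewrite mem_rem_uniq ?iota_uniq// inE mem_iota => /andP[ij im].
  have im' : (1 <= i <= m)%N by lia.
  rewrite h0// add0r mulr0 addr0 (_ : itg _ _ _ = itg 0 (lj i) (fun=> 0)).
    by rewrite itg_cst ?mul0r// ltW// lj_gt0.
  by apply: itg_eq => t _; rewrite /h (negbTE ij) mulr0.
rewrite h0// add0r mulr0 addr0 /h eqxx => gh.
exists M.
have : aeq 0 (lj j) (fun t => g t + - M) (fun=> 0).
  apply: L2_itg0_aeq => //.
  (* Stationarity gives $\int g(g-M)=0$, and $\int M(g-M)=0$ because $M$ is the mean; the difference
     is $\int(g-M)^2$. *)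
  have -> : itg 0 (lj j) (fun t => (g t + - M) ^+ 2) =
     itg 0 (lj j) (fun t => g t * (g t + - M)) + - M * itg 0 (lj j) (fun t => g t + - M).
    rewrite -itgZ; last exact: LgM.1.
    rewrite -itgD; [|exact: L2M|exact/L1Z/LgM.1].
    by apply: itg_eq => t _; ring.
  by rewrite gM0 mulr0 addr0.
apply: (@filterS _ _ (ae_filter_ringOfSetsType mu)) => t + tl => /(_ tl).
by rewrite /g -addrA -opprD => /eqP; rewrite subr_eq0 => /eqP ->; rewrite addrC.
Qed.

Lemma stationary_B phi y Dy : W21_tree y Dy -> conds phi y ->
  (forall v Dv, W21_tree v Dv -> conds (fun=> 0) v -> bilin y Dy v Dv = 0) ->
  solves_B m d k T tau b c phi y Dy.
Proof.
move=> W H B0; have [C _] := H.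
have /choice[K HK] : forall j, exists C, (1 <= j <= m)%N ->
    aeq 0 (lj j) (ell y Dy j) (fun t => C + itg 0 t (weak_coef y Dy j)).
  move=> j; have [jm|jm] := boolP (1 <= j <= m)%N; last by exists 0.
  by have [C' ?] := stationary_quasideriv W C B0 jm; exists C'.
pose E j t := K j + itg 0 t (weak_coef y Dy j).
(* [D1] solves [ell y D1 = E] for the derivative, so the identity holds at every point, including
   those in the Kirchhoff conditions. *)
pose D1 j t := E j t + - b j * y j t + - c j * ydel y j t.
pose D2 j t := weak_coef y Dy j t + - b j * Dy j t + - c j * ydel Dy j t.
have ellE j t : ell y D1 j t = E j t by rewrite /Defs.ell /D1; ring.
have WE j : (1 <= j <= m)%N -> is_wderiv 0 (lj j) (E j) (weak_coef y Dy j).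
  by move=> jm; apply: wderiv_int; exact: weak_coef_L2.
have Wy j : (1 <= j <= m)%N -> is_wderiv 0 (lj j) (y j) (Dy j).
  move=> jm; exact: wderiv_sub (lexx _) (ltW (lj_gt0 jm)) (lj_leT _) (W21_0T W jm).
have WD1 j : (1 <= j <= m)%N -> is_wderiv 0 (lj j) (D1 j) (D2 j).
  move=> jm; apply: wderivD; first apply: wderivD; [exact: WE|exact/wderivZ/Wy|].
  apply: wderivZ.
  exact: wderiv_sub (lexx _) (ltW (lj_gt0 jm)) (lj_leT _) (ydel_wderiv W C jm).
exists D1, D2; split; last split=> //; last split.
- move=> j jm; split; last exact: WD1.
  apply: wderiv_aeq (Wy _ jm); first exact: wderiv_L2 (ltW (lj_gt0 jm)) (WD1 _ jm).
  apply: (@filterS _ _ (ae_filter_ringOfSetsType mu) _ _ _ (HK _ jm)) => t + tl => /(_ tl).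
  by rewrite /D1 /E /Defs.ell => <-; ring.
- move=> j jm; exists (weak_coef y Dy j); split.
    apply: wderiv_eq (WE _ jm); [exact/ltW/lj_gt0|by move=> t _; rewrite ellE|by []].
  apply/aeW => t _.
  have -> : tell m k T tau b c y Dy j t = delay_adjoint (ell y Dy) j t by [].
  by rewrite /weak_coef; ring.
move=> j jd; rewrite -(kirchhoffE D1 H jd).
have jm : (1 <= j <= m)%N by lia.
(* The values of the hat function of $v_j$: [e i] at the end of edge [i], [p i] at its start, and
   [h i] the slope joining them over $[0,l_i]$. *)
pose e i : R := (i == j)%:R.
pose p i : R := (k i == j)%:R.
pose h i (t : R) := (e i - p i) / lj i.
have hE i : (1 <= i <= m)%N -> itg 0 (lj i) (h i) = e i - p i.
  move=> im; rewrite itg_cst ?(ltW (lj_gt0 im))// subr0 divfK// gt_eqF// lj_gt0//.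
have peE i : (1 <= i <= m)%N -> p i + itg 0 (lj i) (h i) = e i.
  by move=> im; rewrite hE// addrC subrK.
have p1 : p 1%N = 0 by rewrite /p k1; case: eqP => // j0; lia.
have Lh i : (1 <= i <= m)%N -> L2 0 (lj i) (h i) by move=> _; exact: L2_cst.
have pk i : (2 <= i <= m)%N -> p i = p (k i) + itg 0 (lj (k i)) (h (k i)).
  by move=> im; rewrite peE//; exact: k_edge.
have pd i : (d < i <= m)%N -> p i + itg 0 (lj i) (h i) = 0.
  by move=> im; rewrite peE /e; [case: eqP => // ij; lia|lia].
have := stationary_test W C B0 p1 Lh pk pd.
(* Almost everywhere $\ell_iy-F_i=K_i$, so each edge gives
   $K_i(e_i-p_i)+F_i(l_i)e_i=E_i(l_i)e_i-K_ip_i$, where $K_i=E_i(0)$. *)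
have -> : \sum_(i <- iota 1 m)
    (itg 0 (lj i) (fun t => (ell y Dy i t - itg 0 t (weak_coef y Dy i)) * h i t) +
     itg 0 (lj i) (weak_coef y Dy i) * (p i + itg 0 (lj i) (h i))) =
  \sum_(i <- iota 1 m) E i (lj i) * e i - \sum_(i <- iota 1 m) K i * p i.
  rewrite -sumrB; apply: eq_sum_edge => i im.
  have lj0 := ltW (lj_gt0 im).
  rewrite peE//.
  have -> : itg 0 (lj i) (fun t => (ell y Dy i t - itg 0 t (weak_coef y Dy i)) * h i t) =
     K i * itg 0 (lj i) (h i).
    have LE : L2 0 (lj i) (ell y Dy i) by apply: L2_sub (ell_L2 W C im) => //; exact: lj_leT.
    have LF : L2 0 (lj i) (fun t => itg 0 t (weak_coef y Dy i)).
      apply: L2_eq (wderiv_L2 lj0 (wderiv_int 0 (weak_coef_L2 W C im))) => t _.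
      by rewrite add0r.
    rewrite -itgZ; last exact: (Lh _ im).1.
    apply: itg_aeq.
    - apply: L2M; last exact: Lh.
      by apply: L2_eq (L2D LE (L2Z (-1) LF)) => t _; rewrite mulN1r.
    - exact: L1Z (Lh _ im).1.
    apply: (@filterS _ _ (ae_filter_ringOfSetsType mu) _ _ _ (HK _ im)) => t + tl => /(_ tl) ->.
    by rewrite addrK.
  by rewrite hE// /E; ring.
rewrite (sum_nodes _ p1 (e := e)); last by move=> i im; rewrite /p /e.
have sum1 (G : nat -> R) n : (j \in iota 1 n) -> \sum_(i <- iota 1 n) G i * e i = G j.
  move=> jn; rewrite (big_rem j)//= /e eqxx mulr1 big_seq big1 ?addr0// => i.
  by rewrite mem_rem_uniq ?iota_uniq// inE => /andP[/negbTE -> _]; rewrite mulr0.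
under [X in _ - X = _]eq_bigr do rewrite mulrC.
rewrite !sum1; [|rewrite mem_iota; lia|rewrite mem_iota; lia].
have -> : lj j = T j by rewrite /Defs.lj; case/andP : jd => _ ->.
move=> S; rewrite -[RHS]S ellE; congr (_ - _).
by apply: eq_bigr => nu _; rewrite ellE /E itg_point addr0.
Qed.

End Tree.

Theorem theorem1 (R : realType) (m d : nat) (k : nat -> nat) (T : nat -> R) (tau : R)
  (b c : nat -> R) (phi : R -> R) (y Dy : nat -> R -> R) :
  (1 <= m)%N -> (d < m)%N ->
  k 1%N = 0%N ->
  (forall j, (2 <= j <= m)%N -> (1 <= k j <= d)%N) ->
  (forall j, (1 <= j <= m)%N -> exists n, iter n k j = 1%N) ->
  (forall j, (1 <= j <= d)%N -> exists nu, (1 <= nu <= m)%N /\ k nu = j) ->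
  (forall j, (1 <= j <= m)%N -> 0 < T j) ->
  0 <= tau ->
  (forall j, (1 <= j <= m)%N -> tau < T j) ->
  (exists dphi, is_wderiv (- tau) 0 phi dphi) ->
  W21_tree m T tau y Dy ->
  (solves_VP m d k T tau b c phi y Dy <-> solves_B m d k T tau b c phi y Dy).
Proof.
move=> _ dm k1 kd _ _ _ tau0 tauT _ W.
have VP := VP_stationary b c dm k1 kd tau0 tauT phi W.
split=> [/VP[H B0]|HB]; first exact: (stationary_B dm k1 kd tau0 tauT W H B0).
apply/VP; split; last exact: (B_stationary dm k1 kd tau0 tauT W HB).
by case: HB => [D1 [D2 [_ []]]].
Qed.
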